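(* There exists an absolute constant $C>0$ such that for every integer $k\ge 2$ and every integer $n\ge 2^{Ck}$ we have $$r(nK_k)=(2k-1)n+r(K_{k-1})-2.$$
   Context: $K_k$ is the complete graph on $k$ vertices, and $nK_k$ denotes the graph consisting of $n$ vertex-disjoint copies of $K_k$. For a graph $G$, the Ramsey number $r(G)$ is the smallest integer $N$ such that every $2$-colouring of the edges of the complete graph on $N$ vertices contains a monochromatic copy of $G$ (as a not necessarily induced subgraph). *)

(* Defs.v *)
From mathcomp Require Import all_boot.

Set Implicit Arguments.
Unset Strict Implicit.
Unset Printing Implicit Defensive.

Record sgraph := SGraph {
  vertex :> finType;
  adj : rel vertex;
  adj_sym : symmetric adj;
  adj_irr : irreflexive adj }.

Section CompleteGraph.
Variable k : nat.

Definition complete_adj : rel 'I_k := fun i j => i != j.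

Lemma complete_sym : symmetric complete_adj.
Proof. by move=> i j; rewrite /complete_adj eq_sym. Qed.

Lemma complete_irr : irreflexive complete_adj.
Proof. by move=> i; rewrite /complete_adj eqxx. Qed.

Definition complete_graph := SGraph complete_sym complete_irr.
End CompleteGraph.

Notation "''K_' k" := (complete_graph k)
  (at level 8, k at level 2, format "''K_' k").

Section DisjointCopies.
Variables (n : nat) (G : sgraph).

Definition copies_adj : rel ('I_n * G)%type :=
  fun u v => (u.1 == v.1) && adj u.2 v.2.

Lemma copies_sym : symmetric copies_adj.
Proof. by move=> u v; rewrite /copies_adj eq_sym adj_sym. Qed.

Lemma copies_irr : irreflexive copies_adj.
Proof. by move=> u; rewrite /copies_adj adj_irr andbF. Qed.

Definition copies := SGraph copies_sym copies_irr.
End DisjointCopies.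

(* Edges are unordered pairs, so a 2-colouring of the edges of 'K_N is a
   boolean function on {set 'I_N}, of which only the values at the two-element
   sets [set f x; f y] are ever read ([f] is injective and [adj] irreflexive). *)
Definition mono_copy (G : sgraph) N (c : {ffun {set 'I_N} -> bool}) (b : bool)
    (f : {ffun G -> 'I_N}) : bool :=
  injectiveb f && [forall x, forall y, adj x y ==> (c [set f x; f y] == b)].

Definition arrows (N : nat) (G : sgraph) : bool :=
  [forall c : {ffun {set 'I_N} -> bool},
    exists b : bool, exists f : {ffun G -> 'I_N}, mono_copy c b f].

Definition mono_clique (T : finType) (c : {set T} -> bool) (b : bool)
    (S : {set T}) : Prop :=
  {in S &, forall x y, x != y -> c [set x; y] = b}.

Lemma mono_cliqueU1 (T : finType) (c : {set T} -> bool) b (x : T) (S : {set T}) :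
  (forall y, y \in S -> c [set x; y] = b) ->
  mono_clique c b S -> mono_clique c b (x |: S).
Proof.
move=> xS clS y z /setU1P[->|yS] /setU1P[->|zS] neq; first by rewrite eqxx in neq.
- exact: xS.
- by rewrite setUC; exact: xS.
- exact: clS.
Qed.

Lemma ramsey_cliques (a b : nat) : exists N, forall (T : finType)
    (c : {set T} -> bool) (A : {set T}), N <= #|A| ->
  exists2 S : {set T}, S \subset A &
    (#|S| = a /\ mono_clique c true S) \/ (#|S| = b /\ mono_clique c false S).
Proof.
have [m] := ubnP (a + b); elim: m a b => // m IHm [|a] [|b] ab;
  try by exists 0 => T c A _; exists set0; rewrite ?sub0set // cards0;
         (left + right); split=> // x y; rewrite inE.
have [M HM] := IHm a b.+1 ltac:(by rewrite addSn in ab).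
have [N HN] := IHm a.+1 b ltac:(by rewrite addnS in ab).
exists (M + N).+1 => T c A leA.
have [x xA] : exists x, x \in A by apply/card_gt0P; apply: leq_trans leA.
pose B (t : bool) : {set T} := [set y in A :\ x | c [set x; y] == t].
have BA t : B t \subset A.
  by apply/subsetP=> y; rewrite !inE => /andP[/andP[]].
have xB t : x \notin B t by rewrite !inE eqxx.
have cB (t : bool) (S : {set T}) : S \subset B t -> forall y, y \in S -> c [set x; y] = t.
  by move=> sSB y yS; have := subsetP sSB y yS; rewrite inE => /andP[_ /eqP].
have cardB : M + N <= #|B true| + #|B false|.
  have -> : #|B true| + #|B false| = #|A :\ x|.
    rewrite -(cardsID [set y | c [set x; y]] (A :\ x)).
    by congr (_ + _); apply: eq_card => y; rewrite !inE; case: (c _);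
       rewrite /= ?andbT ?andbF.
  by move: leA; rewrite (cardsD1 x A) xA add1n ltnS.
have [leM | ltM] := leqP M #|B true|.
  have [S sSB [[cS clS]|clS]] := HM T c _ leM; last first.
    by exists S; [exact: subset_trans (BA true) | right].
  exists (x |: S); first by rewrite subUset sub1set xA (subset_trans sSB).
  left; split; last exact: mono_cliqueU1 (cB _ _ sSB) clS.
  by rewrite cardsU1 cS (contra (subsetP sSB x) (xB _)).
have leN : N <= #|B false|.
  rewrite -(leq_add2l M); apply: leq_trans cardB _.
  by rewrite leq_add2r ltnW.
have [S sSB [clS|[cS clS]]] := HN T c _ leN.
  by exists S; [exact: subset_trans (BA false) | left].
exists (x |: S); first by rewrite subUset sub1set xA (subset_trans sSB).
right; split; last exact: mono_cliqueU1 (cB _ _ sSB) clS.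
by rewrite cardsU1 cS (contra (subsetP sSB x) (xB _)).
Qed.

Lemma arrows_exists (G : sgraph) : exists N, arrows N G.
Proof.
have [N HN] := ramsey_cliques #|G| #|G|; exists N; apply/forallP=> c.
have [S _ clS] := HN _ c [set: 'I_N] ltac:(by rewrite cardsT card_ord).
have {clS} [b [cS clS]] : exists b, #|S| = #|G| /\ mono_clique c b S.
  by case: clS; [exists true | exists false].
apply/existsP; exists b; apply/existsP.
pose g x : 'I_N := enum_val (cast_ord (esym cS) (enum_rank x)).
have g_inj : injective g.
  by move=> x y /enum_val_inj/cast_ord_inj/enum_rank_inj.
exists (finfun g); apply/andP; split.
  by apply/injectiveP=> x y; rewrite !ffunE => /g_inj.
apply/forallP=> x; apply/forallP=> y; apply/implyP=> xy; apply/eqP.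
rewrite !ffunE clS ?enum_valP // (inj_eq g_inj).
by apply: contraTneq xy => ->; rewrite adj_irr.
Qed.

Definition ramsey (G : sgraph) : nat := ex_minn (arrows_exists G).

(* Main.v *)
Require Import Defs.
From mathcomp Require Import all_boot all_order all_algebra.
From mathcomp Require Import reals exp.
From mathcomp Require Import zify.
From mathcomp Require boolp.
Import GRing.Theory Num.Theory.

(** Lower bound: a red clique A on kn - 1 vertices, a blue clique B on
    (k - 1)n - 1 vertices and a set C of r(K_(k-1)) - 1 vertices without
    monochromatic K_(k-1), with A-B and A-C blue and B-C red.

    Upper bound: call "gadget" two disjoint red and two disjoint blue K_k on at
    most 2(2k - 1) - 1 vertices.  Deleting a gadget lowers n by 2 and increases
    the excess of the number of vertices over (2k - 1)n.  The excess of a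
    colouring without monochromatic nK_k is at most 2^O(k), because a large
    excess always leaves a red and a blue K_k sharing a vertex; so we may assume
    that there is no gadget.  A colouring with few disjoint K_k contains (up to
    exchanging colours) a red clique A1 completely joined in blue to a large set
    B without red K_k.  Without gadgets, a maximal red clique A0 containing A1
    and blue to almost all of B absorbs in red all but a set D of vertices with
    bounded red degree to A0 and no red K_k inside.  Then n disjoint blue
    K_(k-1) in D extend to blue K_k through A0, and they exist by the
    off-diagonal bound r(K_(q+1), nK_p) <= pn + r(K_q, K_p) - 1.

    For the latter, with n only exponential in p and q, one tiles D by blue K_p
    leaving few vertices.  A set that minimises the red clique number against
    its size on a logarithmic scale (a "hub") has red degrees at most 1/16 of its
    size, so that most vertices see at least half of most blue 2p-cliques in it;
    leftover vertices linked to the hub are then exchanged along such cliques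
    until fewer than p of them remain.  Iterating on the vertices with few blue
    neighbours in the hub, each further hub contributes a blue (p-1)-clique
    joined in red to what remains, and a vertex of the first hub joined in red
    to all of it bounds the total by r(K_q, K_p) - 1. *)

Set Implicit Arguments.
Unset Strict Implicit.
Unset Printing Implicit Defensive.

(** * Finite sets, monochromatic cliques and the Erdős-Szekeres bound *)

Lemma subset_of_card (T : finType) (A : {set T}) m :
  m <= #|A| -> exists2 B : {set T}, B \subset A & #|B| = m.
Proof.
move=> mA; exists [set:: take m (enum A)].
  by apply/subsetP=> x; rewrite inE => /mem_take; rewrite mem_enum.
by rewrite cardsE (card_uniqP _) ?take_uniq ?enum_uniq // size_takel // -cardE.
Qed.

Lemma cardsDS_leq (T : finType) (A B : {set T}) : #|A| <= #|A :\: B| + #|B|.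
Proof. by rewrite -(cardsID B A) addnC leq_add2l subset_leq_card // subsetIr. Qed.

(** The colouring also has values at singletons; the conjunct [x != y] discards them, so that no
    vertex is its own neighbour in either colour. *)
Definition edge (T : finType) (c : {set T} -> bool) b x y :=
  (x != y) && (c [set x; y] == b).

(** Settles inclusions, disjointness and equalities between Boolean combinations of sets: every
    inclusion or disjointness in the context is instantiated at the point [x], then the membership
    atoms are split. *)
Ltac by_elt x :=
  repeat match goal with
  | H : is_true (?A \subset ?B) |- _ =>
      lazymatch goal with
      | _ : is_true (x \in A) -> is_true (x \in B) |- _ => fail
      | _ => have ? : x \in A -> x \in B by exact: (subsetP H x)
      end
  | H : is_true [disjoint ?A & ?B] |- _ =>
      lazymatch goal with
      | _ : is_true (x \in A) -> is_true (x \notin B) |- _ => fail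
      | _ => have ? : x \in A -> x \notin B by exact: (fun h => negbT (disjointFr H h))
      end
  end;
  repeat match goal with
  | H : is_true (x \in _) -> _ |- _ => move: H
  end;
  rewrite ?inE /=;
  repeat match goal with
  | |- context [x \in ?A] => case: (x \in A)
  | |- context [@edge ?T ?c ?b ?y ?z] => destruct (@edge T c b y z)
  | |- context [?y == ?z] => case: (y == z)
  end; rewrite /= ?andbF ?andbT ?orbT ?orbF /is_true; intuition congruence.

Ltac by_elts :=
  match goal with
  | |- is_true (_ \subset _) => let x := fresh in apply/subsetP=> x; by_elt x
  | |- is_true [disjoint _ & _] =>
      let x := fresh in rewrite disjoint_subset; apply/subsetP=> x; by_elt x
  | |- _ = _ => let x := fresh in apply/setP=> x; by_elt x
  end.

Section Colouring.
Variables (T : finType) (c : {set T} -> bool).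
Implicit Types (b : bool) (x y : T) (A B L P Q S U V W : {set T}).

Local Notation edge := (edge c).
Definition nbh b x := [set y | edge b x y].
Definition clique b S := [forall x in S, forall y in S, (x != y) ==> edge b x y].
Definition has_clique b m U :=
  [exists S : {set T}, [&& S \subset U, #|S| == m & clique b S]].

Lemma edgeC b : symmetric (edge b).
Proof. by move=> x y; rewrite /edge eq_sym setUC. Qed.

Lemma edgexx b x : edge b x x = false.
Proof. by rewrite /edge eqxx. Qed.

Lemma edge_neq b x y : edge b x y -> x != y.
Proof. by case/andP. Qed.

Lemma edgeN b x y : x != y -> edge (~~ b) x y = ~~ edge b x y.
Proof. by rewrite /edge => ->; case: (c _); case: b. Qed.

Lemma edgeF b x y : edge (~~ b) x y -> edge b x y = false.
Proof. by move=> e; apply/negbTE; rewrite -edgeN // (edge_neq e). Qed.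

Lemma nbhE b x y : (y \in nbh b x) = edge b x y.
Proof. by rewrite inE. Qed.

Lemma cliqueP b S :
  reflect {in S &, forall x y, x != y -> edge b x y} (clique b S).
Proof.
apply: (iffP forall_inP) => [H x y xS yS|H x xS].
  exact/implyP/(forall_inP (H x xS)).
by apply/forall_inP=> y yS; apply/implyP; apply: H.
Qed.

Lemma sub_clique b S S' : S' \subset S -> clique b S -> clique b S'.
Proof.
move=> /subsetP sS /cliqueP cS; apply/cliqueP=> x y /sS xS /sS yS; exact: cS.
Qed.

Lemma clique0 b : clique b set0.
Proof. by apply/cliqueP=> x y; rewrite inE. Qed.

Lemma cliqueU1 b x S : S \subset nbh b x -> clique b S -> clique b (x |: S).
Proof.
move=> /subsetP xS /cliqueP cS; apply/cliqueP=> y z.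
move=> /setU1P[->|yS] /setU1P[->|zS] yz; first by rewrite eqxx in yz.
- by move: (xS _ zS); rewrite nbhE.
- by move: (xS _ yS); rewrite nbhE edgeC.
- exact: cS.
Qed.

Lemma has_cliqueP b m U :
  reflect (exists S, [/\ S \subset U, #|S| = m & clique b S]) (has_clique b m U).
Proof.
apply: (iffP existsP) => [] [S]; first by case/and3P=> ? /eqP ? ?; exists S.
by case=> ? /eqP ? ?; exists S; apply/and3P.
Qed.

Lemma has_clique_sub b m U U' : U \subset U' -> has_clique b m U -> has_clique b m U'.
Proof.
move=> sU /has_cliqueP[S [SU cS kS]]; apply/has_cliqueP; exists S; split=> //.
exact: subset_trans sU.
Qed.

Lemma has_clique_leq b m m' U : m' <= m -> has_clique b m U -> has_clique b m' U.
Proof.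
move=> lem /has_cliqueP[S [SU cS kS]].
have [|S' S'S cS'] := @subset_of_card _ S m'; first by rewrite cS.
apply/has_cliqueP; exists S'; split=> //; first exact: subset_trans SU.
exact: sub_clique kS.
Qed.

Lemma has_cliqueS b m x U :
  x \in U -> has_clique b m (U :&: nbh b x) -> has_clique b m.+1 U.
Proof.
move=> xU /has_cliqueP[S [SU cS kS]]; apply/has_cliqueP; exists (x |: S).
have Sx : S \subset nbh b x by rewrite (subset_trans SU) // subsetIr.
split; last exact: cliqueU1.
  by rewrite subUset sub1set xU (subset_trans SU) // subsetIl.
rewrite cardsU1 cS [x \in S](negbTE _) //; apply/negP => /(subsetP Sx).
by rewrite nbhE edgexx.
Qed.

Lemma card_nbh_split b x U :
  #|U| = (x \in U) + #|U :&: nbh b x| + #|U :&: nbh (~~ b) x|.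
Proof.
rewrite (cardsD1 x) -addnA; congr (_ + _).
rewrite -(cardsID (nbh b x)); congr (_ + _); apply: eq_card => y; rewrite !inE.
  by case: (eqVneq y x) => [->|_]; rewrite ?edgexx /= ?andbF.
case: (eqVneq y x) => [->|yx]; rewrite ?edgexx /= ?andbF //.
by rewrite edgeN 1?eq_sym // andbC.
Qed.

(** Remove a vertex [x]: the remaining vertices split into its two neighbourhoods, one of which has
    at least half of the required power of two, and induction on [p + q] applies there. Only
    exponential bounds are needed, so binomial coefficients are avoided. *)
Lemma erdos_szekeres b p q U :
  2 ^ (p + q) <= #|U| -> has_clique b p U || has_clique (~~ b) q U.
Proof.
have nil b' : has_clique b' 0 U.
  by apply/has_cliqueP; exists set0; rewrite sub0set cards0 clique0.
have [m] := ubnP (p + q); elim: m p q U nil => // m IHm [|p] [|q] U nil;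
  rewrite ?nil ?orbT //= => pq leU.
have [x xU] : exists x, x \in U.
  by apply/card_gt0P; rewrite (leq_trans _ leU) // expn_gt0.
have nilU b' V : has_clique b' 0 V.
  by apply/has_cliqueP; exists set0; rewrite sub0set cards0 clique0.
move: (card_nbh_split b x U); rewrite xU => cU.
have e2 : 2 ^ (p.+1 + q.+1) = 2 * 2 ^ (p + q).+1.
  by rewrite addSn addnS -expnS.
have [le1|lt1] := leqP (2 ^ (p + q).+1) #|U :&: nbh b x|.
  have /orP[] := IHm p q.+1 (U :&: nbh b x) (fun _ => nilU _ _)
      ltac:(lia) ltac:(by rewrite addnS).
    by move=> /(has_cliqueS xU) ->.
  by move=> /(has_clique_sub (subsetIl _ _)) ->; rewrite orbT.
have /orP[] := IHm p.+1 q (U :&: nbh (~~ b) x) (fun _ => nilU _ _)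
      ltac:(lia) ltac:(rewrite addSn; lia).
  by move=> /(has_clique_sub (subsetIl _ _)) ->.
by move=> /(has_cliqueS xU) ->; rewrite orbT.
Qed.

Lemma no_clique_bound b p q U :
  ~~ has_clique b p U -> ~~ has_clique (~~ b) q U -> #|U| < 2 ^ (p + q).
Proof.
by move=> np nq; rewrite ltnNge; apply/negP => /(erdos_szekeres b);
   rewrite (negbTE np) (negbTE nq).
Qed.

(** * Tilings by monochromatic cliques *)

(** A recursion over the cliques rather than a set of sets: concatenating tilings is a plain
    induction, and the count [t] stays meaningful for [p = 0], where a set of sets would merge the
    empty cliques. [tiles_pool] and [pool_tiles] pass between both forms. *)
Fixpoint tiles b p t U : Prop :=
  if t is t'.+1 then
    exists S, [/\ S \subset U, #|S| = p, clique b S & tiles b p t' (U :\: S)]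
  else U = set0.

Definition packs b p t U := exists2 V : {set T}, V \subset U & tiles b p t V.

Lemma tiles_card b p t U : tiles b p t U -> #|U| = p * t.
Proof.
elim: t U => [|t IHt] U /=; first by move->; rewrite cards0 muln0.
by case=> S [SU cS _ /IHt]; rewrite cardsDS // mulnS => <-; 
   rewrite -cS subnKC // subset_leq_card.
Qed.

Lemma tilesU b p t s U W :
  [disjoint U & W] -> tiles b p t U -> tiles b p s W -> tiles b p (t + s) (U :|: W).
Proof.
elim: t U => [|t IHt] U dUW /=; first by move->; rewrite set0U.
case=> S [SU cS kS tU] tW; exists S; split=> //; first by_elts.
have -> : (U :|: W) :\: S = (U :\: S) :|: W by by_elts.
by apply: IHt => //; by_elts.
Qed.

Lemma tiles1 b S : clique b S -> tiles b #|S| 1 S.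
Proof. by move=> kS; exists S; split=> //=; rewrite setDv. Qed.

Lemma clique_tiles b p t S : clique b S -> #|S| = p * t -> tiles b p t S.
Proof.
elim: t S => [|t IHt] S kS; first by rewrite muln0 => /cards0_eq.
rewrite mulnS => cS.
have [|S' S'S cS'] := @subset_of_card _ S p; first by rewrite cS leq_addr.
exists S'; split=> //; first exact: sub_clique kS.
apply: IHt; first by apply: sub_clique kS; apply: subsetDl.
by rewrite cardsDS // cS cS' addKn.
Qed.

Lemma packs_sub b p t U U' : U \subset U' -> packs b p t U -> packs b p t U'.
Proof. by move=> sU [V VU tV]; exists V => //; apply: subset_trans sU. Qed.

Lemma packsU b p t s U W : [disjoint U & W] ->
  packs b p t U -> packs b p s W -> packs b p (t + s) (U :|: W).
Proof.
move=> dUW [U' sU tU] [W' sW tW]; exists (U' :|: W'); first exact: setUSS.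
by apply: tilesU => //; by_elts.
Qed.

Lemma packsS b p t S U : S \subset U -> #|S| = p -> clique b S ->
  packs b p t (U :\: S) -> packs b p t.+1 U.
Proof.
move=> SU cS kS pU; rewrite -add1n.
have -> : U = S :|: (U :\: S) by by_elts.
apply: packsU => //; first by by_elts.
by exists S => //; rewrite -cS; apply: tiles1.
Qed.

Lemma packs_leq b p t s U : s <= t -> packs b p t U -> packs b p s U.
Proof.
elim: t s U => [|t IHt] [|s] U // st.
  by move=> _; exists set0; rewrite ?sub0set.
case=> V VU /= [S [SV cS kS tV]].
apply: packs_sub VU _; apply: packsS SV cS kS _; apply: IHt => //.
by exists (V :\: S).
Qed.

(** Cliques are removed greedily; if this stops after at most [n] removals, what remains is [W]. *)
Lemma packs_or_free b p n U :
  packs b p n.+1 U \/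
  exists2 W : {set T}, W \subset U & ~~ has_clique b p W /\ #|U| <= #|W| + p * n.
Proof.
elim: n U => [|n IHn] U.
  case h: (has_clique b p U); last by right; exists U => //; rewrite h muln0 addn0.
  case/has_cliqueP: h => S [SU cS kS]; left; apply: packsS SU cS kS _.
  by exists set0; rewrite ?sub0set.
case h: (has_clique b p U); last by right; exists U => //; rewrite h leq_addr.
case/has_cliqueP: h => S [SU cS kS].
have [pU|[W WU [nW cW]]] := IHn (U :\: S); first by left; apply: packsS SU cS kS _.
right; exists W; first by apply: subset_trans WU _; apply: subsetDl.
by split=> //; move: cW; have := cardsDS_leq U S; rewrite cS mulnS; lia.
Qed.

Lemma greedy_tiles b p U : 0 < p ->
  exists t, exists2 L : {set T}, L \subset U & tiles b p t (U :\: L) /\ ~~ has_clique b p L.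
Proof.
move=> p0; have [m] := ubnP #|U|; elim: m U => // m IHm U cU.
case h: (has_clique b p U); last first.
  by exists 0, U => //; rewrite h /= setDv.
case/has_cliqueP: h => S [SU cS kS].
have [|t [L LU [tU nL]]] := IHm (U :\: S).
  by rewrite cardsDS // cS; have := subset_leq_card SU; lia.
exists t.+1, L; first by apply: subset_trans LU _; apply: subsetDl.
split=> //; exists S; split=> //; first by_elts.
by have -> : (U :\: L) :\: S = (U :\: S) :\: L by by_elts.
Qed.

Lemma packs_large b p q t U : ~~ has_clique (~~ b) q U ->
  p * t + 2 ^ (p + q) <= #|U| -> packs b p t U.
Proof.
move=> nU cU; case: t cU => [|t] cU; first by exists set0; rewrite ?sub0set.
have [//|[W WU [nW cW]]] := packs_or_free b p t U.
have nW' : ~~ has_clique (~~ b) q W.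
  by apply: contra nU; apply: has_clique_sub.
by have := no_clique_bound nW nW'; rewrite mulnS in cU; lia.
Qed.

End Colouring.

(* Cardinals of sets of sets mention [reverse_coercion], which [lia] sees as
   making them distinct atoms. *)
Ltac setlia := unfold reverse_coercion in *; lia.

(** * Hubs, and exchanges along cliques inside them *)

Section Hubs.
Variables (T : finType) (c : {set T} -> bool).
Implicit Types (b : bool) (x y : T) (A B L Q S U V W X Y : {set T}) (P R : {set {set T}}).
Local Notation edge := (edge c).
Local Notation nbh := (nbh c).
Local Notation clique := (clique c).
Local Notation has_clique := (has_clique c).
Local Notation tiles := (tiles c).

Lemma double_count b A B :
  \sum_(x in A) #|B :&: nbh b x| = \sum_(y in B) #|A :&: nbh b y|.
Proof.
have E x D : #|D :&: nbh b x| = \sum_(y in D) edge b x y.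
  rewrite -sum1_card big_mkcond [RHS]big_mkcond; apply: eq_bigr => y _.
  by rewrite !inE; case: (y \in D) => //=; case: (edge b x y).
under eq_bigr => x _ do rewrite E.
under [RHS]eq_bigr => x _ do rewrite E.
by rewrite exchange_big; apply: eq_bigr => y _; apply: eq_bigr => x _; rewrite edgeC.
Qed.

Lemma card_cover_setI P A : trivIset P ->
  \sum_(Y in P) #|Y :&: A| = #|cover P :&: A|.
Proof.
move=> tP.
have E D : #|D :&: A| = \sum_(y in D) (y \in A).
  rewrite -sum1_card big_mkcond [RHS]big_mkcond; apply: eq_bigr => y _.
  by rewrite !inE; case: (y \in D) => //=; case: (y \in A).
by under eq_bigr => Y _ do rewrite E; rewrite E big_trivIset.
Qed.

(* A vertex of red degree above 1/16 is paid for by the drop of the red clique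
   number in its red neighbourhood. *)
Lemma exists_hub b q s U : s * 16 ^ q <= #|U| -> ~~ has_clique b q U ->
  exists2 H : {set T}, H \subset U &
    s <= #|H| /\ forall x, x \in H -> 16 * #|H :&: nbh b x| <= #|H|.
Proof.
elim: q U => [|q IHq] U sU nU.
  case/negP: nU; apply/has_cliqueP; exists set0.
  by rewrite sub0set cards0 clique0.
case: (boolP [forall x in U, 16 * #|U :&: nbh b x| <= #|U|]) => [/forall_inP h|].
  by exists U => //; split=> //; apply: leq_trans sU; rewrite leq_pmulr ?expn_gt0.
case/forall_inPn => x xU; rewrite -ltnNge => dx.
have [||H HU hH] := IHq (U :&: nbh b x).
- by rewrite expnS in sU; lia.
- by apply: contra nU; apply: has_cliqueS.
by exists H => //; apply: subset_trans HU _; apply: subsetIl.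
Qed.

Lemma clique_card_nbh b Y u : clique b Y -> u \in Y -> #|Y :&: nbh b u| = #|Y|.-1.
Proof.
move=> kY uY; rewrite (cardsD1 u Y) uY; apply: eq_card => y; rewrite !inE.
case: (eqVneq y u) => [->|yu] /=; first by rewrite edgexx andbF.
by case yY: (y \in Y) => //=; rewrite (cliqueP _ _ _ kY) // eq_sym.
Qed.

Lemma tilesU_eq b p t s U W V : [disjoint U & W] -> V = U :|: W ->
  tiles b p t U -> tiles b p s W -> tiles b p (t + s) V.
Proof. by move=> dUW ->; apply: tilesU. Qed.

Lemma sub_cover P Y : Y \in P -> Y \subset cover P.
Proof. exact: bigcup_sup. Qed.

Lemma tiles_pool b p t U : 0 < p -> tiles b p t U ->
  exists P, [/\ trivIset P, cover P = U, #|P| = t &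
                forall Y, Y \in P -> #|Y| = p /\ clique b Y].
Proof.
move=> p0; elim: t U => [|t IHt] U /=.
  move=> ->; exists set0; rewrite cards0 /cover big_set0; split=> //.
    by apply/trivIsetP=> A B; rewrite inE.
  by move=> Y; rewrite inE.
case=> S [SU cS kS /IHt[P [tP cP nP kP]]].
have SP Y : Y \in P -> [disjoint S & Y].
  by move=> /sub_cover; rewrite cP => YU; by_elts.
have nSP : S \notin P.
  apply/negP => /SP; rewrite -setI_eq0 setIid => /eqP S0.
  by rewrite S0 cards0 in cS; rewrite -cS in p0.
exists (S |: P); split.
- apply/trivIsetP=> A B /setU1P[->|AP] /setU1P[->|BP] AB; rewrite ?eqxx // in AB *.
  + exact: SP.
  + by rewrite disjoint_sym; apply: SP.
  + exact: (trivIsetP tP).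
- by rewrite /cover bigcup_setU big_set1 -/(cover P) cP; by_elts.
- by rewrite cardsU1 nSP nP.
- by move=> Y /setU1P[->|/kP].
Qed.

(** Each clique of [P] is cut into [d] cliques of size [p]. *)
Lemma pool_tiles b m p d P : trivIset P ->
  (forall Y, Y \in P -> #|Y| = p * d /\ clique b Y) ->
  m = d * #|P| -> tiles b p m (cover P).
Proof.
have [n] := ubnP #|P|; elim: n P m => // n IHn P m cP tP kP ->.
have [->|[Y YP]] := set_0Vmem P.
  by rewrite cards0 muln0 /cover big_set0.
have [cY kY] := kP Y YP; have sY := sub_cover YP.
rewrite (cardsD1 Y) YP mulnDr muln1.
apply: (@tilesU_eq _ _ _ _ Y (cover (P :\ Y))); rewrite ?coverD1 //.
- by by_elts.
- by by_elts.
- exact: clique_tiles.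
rewrite -coverD1 //; apply: IHn => //.
- by rewrite (cardsD1 Y) YP add1n ltnS in cP.
- exact: trivIsetD.
- by move=> Z /setD1P[_ /kP].
Qed.

(* One unit of deficiency travels from [u] to [w] through the clique [Y]. *)
Lemma shift_tiles b p Y u w : 0 < p -> clique b Y -> #|Y| = 2 * p ->
  u \notin Y -> w \in Y -> p <= #|Y :&: nbh b u| -> tiles b p 2 ((u |: Y) :\ w).
Proof.
move=> p0 kY cY uY wY gY.
have uw : u != w by apply: contraNneq uY => ->.
have [|S SY cS] := @subset_of_card _ ((Y :&: nbh b u) :\ w) p.-1.
  by have := cardsD1 w (Y :&: nbh b u); case: (_ \in _); lia.
have SY' : S \subset Y by by_elts.
have wS : w \notin S by apply/negP => /(subsetP SY); rewrite !inE eqxx.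
have uS : u \notin S by apply: contra uY; apply: (subsetP SY').
have kS : clique b (u |: S).
  by apply: cliqueU1; [by_elts | apply: sub_clique kY].
have cU : #|u |: S| = p by rewrite cardsU1 uS cS; lia.
rewrite -[2]/(1 + 1).
apply: (@tilesU_eq _ _ _ _ (u |: S) ((Y :\: S) :\ w)).
- rewrite disjoint_subset; apply/subsetP=> x; rewrite !inE => /orP[/eqP->|xS].
    by rewrite (negbTE uY) !andbF.
  by rewrite xS andbF.
- apply/setP=> x; rewrite !inE; case: (eqVneq x w) => [->|_] /=.
    by rewrite eq_sym (negbTE uw) (negbTE wS).
  by case: (x == u) => //=; case xS: (x \in S) => //=; rewrite (subsetP SY').
- by apply: clique_tiles => //; rewrite muln1.
- apply: clique_tiles; first by apply: sub_clique kY; by_elts.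
  have := cardsD1 w (Y :\: S); rewrite !inE wS wY cardsDS // cS cY; lia.
Qed.

(** * Absorption of leftover vertices by a pool [P] of disjoint 2p-cliques (blue is [b]) *)

Section Pool.
Variables (b : bool) (p q : nat) (X : {set T}) (P : {set {set T}}).
Hypotheses (p_gt0 : 0 < p) (X_free : ~~ has_clique (~~ b) q X).
Hypothesis X_deg : forall x, x \in X -> 8 * #|X :&: nbh (~~ b) x| <= #|X|.
Hypotheses (P_triv : trivIset P) (P_sub : cover P \subset X).
Hypothesis P_clique : forall Y, Y \in P -> #|Y| = 2 * p /\ clique b Y.
Hypothesis P_large : 3 * #|X| <= 8 * p.+1 * #|P|.

(** When [u] is not bad for [Y], it still has p - 1 blue neighbours in [Y] after any one vertex of
    [Y] is set aside, which is what [shift_tiles] needs. *)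
Let bad u Y := #|Y :&: nbh b u| < p.

Let bad_nbhN u Y : Y \in P -> bad u Y -> p.+1 <= #|Y :&: nbh (~~ b) u|.
Proof.
move=> /P_clique[cY kY] badY; have := card_nbh_split c b u Y.
rewrite /bad in badY; case uY: (u \in Y); last by setlia.
by rewrite (clique_card_nbh kY uY) in badY; setlia.
Qed.

(** Each bad clique uses p + 1 of the red degree of [u], which is at most 1/8 of the size of [X];
    [P_large] turns this into a third of the pool. *)
Let few_bad_from u : u \in X -> 3 * #|[set Y in P | bad u Y]| <= #|P|.
Proof.
move=> uX; set B := [set Y in P | _].
have BP : B \subset P by apply/subsetP=> Y; rewrite inE => /andP[].
have tB := trivIsetS BP P_triv.
have sB : cover B \subset X.
  by apply: subset_trans P_sub; apply/bigcupsP => Y YB; apply: sub_cover (subsetP BP _ YB).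
have : p.+1 * #|B| <= #|X :&: nbh (~~ b) u|.
  apply: leq_trans (_ : #|cover B :&: nbh (~~ b) u| <= _); last first.
    by apply: subset_leq_card; by_elts.
  rewrite -card_cover_setI // mulnC -sum_nat_const; apply: leq_sum => Y.
  by rewrite inE => /andP[]; apply: bad_nbhN.
move/(_ _ uX): X_deg => dX h.
have : 8 * (p.+1 * (3 * #|B|)) <= 8 * (p.+1 * #|P|) by setlia.
by rewrite !leq_pmul2l.
Qed.

(** Double count the red edges between [Y0] and the cliques all of whose vertices are bad for [Y0]:
    each such clique sends at least 2p(p + 1) of them, while the 2p vertices of [Y0] have red degree
    at most 1/8 of the size of [X]. *)
Let few_bad_to Y0 : Y0 \in P ->
  3 * #|[set Y in P | [forall y in Y, bad y Y0]]| <= #|P|.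
Proof.
move=> Y0P; set B := [set Y in P | _].
have BP : B \subset P by apply/subsetP=> Y; rewrite inE => /andP[].
have tB := trivIsetS BP P_triv.
have sB : cover B \subset X.
  by apply: subset_trans P_sub; apply/bigcupsP => Y YB; apply: sub_cover (subsetP BP _ YB).
have [cY0 kY0] := P_clique Y0P.
have Y0X : Y0 \subset X := subset_trans (sub_cover Y0P) P_sub.
have : #|B| * (2 * p * p.+1) <= \sum_(y in cover B) #|Y0 :&: nbh (~~ b) y|.
  rewrite (@big_trivIset _ _ _ _ _ (fun y => #|Y0 :&: nbh (~~ b) y|) tB).
  rewrite -sum_nat_const; apply: leq_sum => Y.
  rewrite inE => /andP[YP /forall_inP hY]; have [<- _] := P_clique YP.
  by rewrite -sum_nat_const; apply: leq_sum => y /hY; apply: bad_nbhN.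
rewrite double_count => h.
have h2 : 8 * \sum_(y in Y0) #|cover B :&: nbh (~~ b) y| <= 2 * p * #|X|.
  rewrite big_distrr /= -cY0 -sum_nat_const; apply: leq_sum => y /(subsetP Y0X) yX.
  apply: leq_trans (X_deg yX); rewrite leq_mul2l; apply/orP; right.
  by apply: subset_leq_card; by_elts.
have : (16 * p) * (p.+1 * (3 * #|B|)) <= (16 * p) * (p.+1 * #|P|).
  apply: leq_trans (_ : 3 * (2 * p * #|X|) <= _); first by setlia.
  have := leq_mul (leqnn (2 * p)) P_large; setlia.
by rewrite !leq_pmul2l // muln_gt0.
Qed.

(** As [R] has more than two thirds of the pool, some [Y] in [R] avoids both exceptional thirds.
    Then [u] replaces some [y] in [Y], and [y] replaces [w] in [Y0]: the vertex left uncovered moves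
    from [u] to the prescribed [w]. *)
Let exchange_pair R u Y0 w : R \subset P -> 2 * #|P| < 3 * #|R| ->
  u \in X -> u \notin cover P -> Y0 \in P -> Y0 \notin R -> w \in Y0 ->
  exists2 Y, Y \in R & tiles b p 4 ((u |: Y) :|: (Y0 :\ w)).
Proof.
move=> RP cR uX uP Y0P Y0R wY0.
set B1 := [set Y in P | bad u Y].
set B2 := [set Y in P | [forall y in Y, bad y Y0]].
have [Y /setDP[YR]] : exists Y, Y \in R :\: (B1 :|: B2).
  apply/card_gt0P; have := cardsDS_leq R (B1 :|: B2).
  have [+ _] := leq_card_setU B1 B2; have := few_bad_from uX; have := few_bad_to Y0P.
  by rewrite -/B1 -/B2; setlia.
have YP := subsetP RP _ YR; rewrite !inE YP /= negb_or -leqNgt => /andP[gY].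
case/forall_inPn=> y yY; rewrite -leqNgt => gy.
exists Y => //.
have uNY Z : Z \in P -> u \notin Z.
  by move=> ZP; apply: contra uP; apply: (subsetP (sub_cover ZP)).
have dY : [disjoint Y & Y0].
  by apply: (trivIsetP P_triv) => //; apply: contraNneq Y0R => <-.
have yY0 : y \notin Y0 by apply: contraTN yY => yY0; rewrite (disjointFl dY).
have [cY kY] := P_clique YP; have [cY0 kY0] := P_clique Y0P.
apply: (@tilesU_eq _ _ 2 2 ((u |: Y) :\ y) ((y |: Y0) :\ w)); last 2 first.
- by apply: shift_tiles => //; apply: uNY.
- exact: shift_tiles.
- rewrite disjoint_subset; apply/subsetP=> x; rewrite !inE.
  case: (eqVneq x y) => //= xy /orP[/eqP->|xY]; first by rewrite (negbTE (uNY _ Y0P)) andbF.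
  by rewrite (disjointFr dY xY) andbF.
- apply/setP=> x; rewrite !inE; case: (eqVneq x y) => [->|xy] //=.
  rewrite yY orbT /=; have -> // : y != w by apply: contraNneq yY0 => ->.
Qed.

(** The vertices of [L] are traded one by one for those of [W], which lie in distinct cliques
    outside [R]. Each trade consumes one intermediate clique of [R], whence the slack [3 * j]. *)
Let exchange_many j : forall R L W, R \subset P -> 2 * #|P| + 3 * j <= 3 * #|R| ->
  L \subset X -> [disjoint L & cover P] -> #|L| = j -> #|W| = j ->
  W \subset cover (P :\: R) -> {in W &, injective (pblock P)} ->
  exists R', [/\ R' \subset R, #|R'| = j &
    tiles b p (4 * j)
      ((L :|: cover R') :|: \bigcup_(w in W) (pblock P w :\ w))].
Proof.
elim: j => [|j IHj] R L W RP cR LX dL cL cW WR Winj.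
  exists set0; rewrite sub0set cards0; split=> //.
  by rewrite (cards0_eq cL) (cards0_eq cW) /cover !big_set0 !set0U.
have [u uL] : exists u, u \in L by apply/card_gt0P; rewrite cL.
have [w wW] : exists w, w \in W by apply/card_gt0P; rewrite cW.
have WP v : v \in W -> pblock P v \in P :\: R /\ v \in pblock P v.
  move=> /(subsetP WR) /bigcupP[Y YPR vY]; have /setDP[YP _] := YPR.
  by rewrite (def_pblock P_triv YP vY).
have [Y0 [Y0P Y0R wY0]] : exists Y0, [/\ Y0 \in P, Y0 \notin R & w \in Y0].
  by exists (pblock P w); have [/setDP[]] := WP w wW.
have [|||Y YR tY] := @exchange_pair R u _ w RP _ _ _ Y0P Y0R wY0.
- by clear -cR; setlia.
- exact: subsetP LX _ uL.
- by rewrite (disjointFr dL).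
have YP := subsetP RP _ YR.
have [||||||||R' [R'R cR' tR']] := IHj (R :\ Y) (L :\ u) (W :\ w).
- by by_elts.
- by rewrite (cardsD1 Y R) YR add1n in cR; clear -cR; setlia.
- by by_elts.
- by by_elts.
- by move: cL; rewrite (cardsD1 u) uL => -[].
- by move: cW; rewrite (cardsD1 w) wW => -[].
- apply/subsetP=> v /setD1P[_ /WP[/setDP[vP vR] vv]].
  apply/bigcupP; exists (pblock P v) => //; rewrite !inE vP andbT negb_and.
  by rewrite vR orbT.
- by move=> v v' /setD1P[_ vW] /setD1P[_ v'W]; apply: Winj.
have YR' : Y \notin R' by apply/negP=> /(subsetP R'R); rewrite !inE eqxx.
exists (Y |: R'); split.
- by rewrite subUset sub1set YR /=; by_elts.
- by rewrite cardsU1 YR' cR'.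
rewrite mulnS; apply: tilesU_eq tY tR'.
  have defY := def_pblock P_triv YP; have defY0 := def_pblock P_triv Y0P.
  rewrite disjoint_sym disjoint_subset; apply/subsetP=> x.
  have RX : x \in cover R' -> x \in cover P /\ pblock P x \in R :\ Y.
    case/bigcupP=> Z /(subsetP R'R) ZR xZ; have /setD1P[_ ZR'] := ZR.
    have ZP := subsetP RP _ ZR'.
    by rewrite (def_pblock P_triv ZP xZ); split=> //; apply: (subsetP (sub_cover ZP)).
  have WX : x \in \bigcup_(v in W :\ w) (pblock P v :\ v) ->
      [/\ x \in cover P, pblock P x \notin R & pblock P x != Y0].
    case/bigcupP=> v /setD1P[vw vW] /setD1P[_ xv]; have [/setDP[vP vR] vv] := WP v vW.
    rewrite (def_pblock P_triv vP xv); split=> //; first exact: (subsetP (sub_cover vP)).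
    rewrite -(def_pblock P_triv Y0P wY0); apply: contra vw => /eqP vw.
    by apply/eqP; apply: Winj.
  have uP : u \notin cover P by rewrite (disjointFr dL).
  have pY : x \in Y -> x \in cover P by apply: (subsetP (sub_cover YP)).
  have pY0 : x \in Y0 -> x \in cover P by apply: (subsetP (sub_cover Y0P)).
  rewrite in_setU in_setU => h; rewrite !inE !negb_or !negb_and.
  case/orP: h => [/orP[/setD1P[xu xL]|/RX[xP xR]]|/WX[xP xR xY0]].
  - have xP : x \notin cover P by rewrite (disjointFr dL).
    by rewrite xu (contra pY xP) (contra pY0 xP) orbT.
  - have -> : x != u by apply: contraTneq xP => ->.
    have /setD1P[nY rR] := xR.
    have -> : x \notin Y by apply: contra nY => /defY ->.
    by rewrite [x \notin Y0](contra _ Y0R) ?orbT // => /defY0 <-.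
  - have -> : x != u by apply: contraTneq xP => ->.
    have -> : x \notin Y by apply: contra xR => /defY ->.
    by rewrite [x \notin Y0](contra _ xY0) ?orbT // => /defY0 ->.
rewrite /cover bigcup_setU big_set1 -/(cover R') (big_setD1 w) //=.
by rewrite (def_pblock P_triv Y0P wY0); apply/setP=> x; rewrite !in_setU !in_setD1 !in_set1;
   case: (eqVneq x u) => [->|xu]; rewrite ?uL /= ?orbT //; case: (x \in L); 
   case: (x \in Y); case: (x \in cover R'); rewrite ?orbT ?orbF.
Qed.

(** Choose a representative in every clique of [R]. There are enough of them to contain a blue
    p-clique [W], since [X] has no red q-clique. Trading [L] for [W] leaves uncovered a set that is
    itself a tile. This uses p cliques that host [W] and p intermediate ones. *)
Let absorb_step R L : R \subset P -> L \subset X -> [disjoint L & cover P] ->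
  #|L| = p -> 2 * #|P| + 6 * p <= 3 * #|R| -> 2 ^ (p + q) <= #|R| ->
  exists R', [/\ R' \subset R, #|R'| = 2 * p &
    exists t, tiles b p t (L :|: cover R')].
Proof.
move=> RP LX dL cL cR KR.
have RPP Y : Y \in R -> Y \in P by apply: (subsetP RP).
have ne Y : Y \in R -> exists x, x \in Y.
  by move=> /RPP/P_clique[cY _]; apply/card_gt0P; rewrite cY muln_gt0.
have [x0 _] : exists x, x \in L by apply/card_gt0P; rewrite cL.
pose r Y := odflt x0 [pick x in Y].
have rP Y : Y \in R -> r Y \in Y.
  by move=> /ne[x xY]; rewrite /r; case: pickP => // /(_ x); rewrite xY.
have rK Y : Y \in R -> pblock P (r Y) = Y.
  by move=> YR; apply: def_pblock => //; [apply: RPP | apply: rP].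
have rX : r @: R \subset X.
  apply/subsetP=> _ /imsetP[Y YR ->]; apply: (subsetP P_sub).
  by apply: (subsetP (sub_cover (RPP _ YR))); apply: rP.
have cr : #|r @: R| = #|R|.
  by apply: card_in_imset => Y Y' YR Y'R e; rewrite -(rK Y) // e rK.
have : has_clique b p (r @: R).
  have := @erdos_szekeres _ c b p q (r @: R); rewrite cr => /(_ KR) /orP[//|].
  by move=> /(has_clique_sub rX); rewrite (negbTE X_free).
case/has_cliqueP=> W [Wr cW kW].
have WR w : w \in W -> pblock P w \in R /\ w \in pblock P w.
  by move=> /(subsetP Wr)/imsetP[Y YR ->]; rewrite rK //; split=> //; apply: rP.
have Winj : {in W &, injective (pblock P)}.
  move=> w w' /(subsetP Wr)/imsetP[Y YR ->] /(subsetP Wr)/imsetP[Y' Y'R ->].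
  by rewrite !rK // => ->.
pose B := pblock P @: W.
have cB : #|B| = p by rewrite card_in_imset.
have BR : B \subset R by apply/subsetP=> _ /imsetP[w /WR[wR _] ->].
have [|||R' [R'R cR' tR']] := @exchange_many p (R :\: B) L W _ _ LX dL cL cW _ Winj.
- by apply: subset_trans RP; apply: subsetDl.
- by rewrite cardsDS // cB; clear -cR; setlia.
- apply/subsetP=> w wW; have [wR ww] := WR w wW; apply/bigcupP.
  exists (pblock P w) => //; rewrite !inE (RPP _ wR) andbT negb_and negbK.
  by rewrite imset_f.
exists (R' :|: B); split.
- by rewrite subUset BR andbT; apply: subset_trans R'R (subsetDl _ _).
- have dRB : [disjoint R' & B].
    by rewrite disjoint_subset; apply/subsetP=> Y /(subsetP R'R)/setDP[].
  by rewrite cardsU (disjoint_setI0 dRB) cards0 subn0 cR' cB mul2n addnn.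
exists (4 * p + 1); apply: tilesU_eq tR' (_ : tiles b p 1 W); last first.
- by apply: clique_tiles => //; rewrite muln1.
- rewrite /cover bigcup_setU setUA -/(cover R'); apply/setP=> x; rewrite !in_setU.
  rewrite -!orbA; congr (_ || (_ || _)).
  apply/bigcupP/orP=> [[_ /imsetP[w wW ->] xw]|[/bigcupP[w wW /setD1P[_ xw]]|xW]].
  + have [->|xw'] := eqVneq x w; first by right.
    by left; apply/bigcupP; exists w => //; rewrite !inE xw'.
  + by exists (pblock P w) => //; apply: imset_f.
  + by exists (pblock P x); [apply: imset_f | have [] := WR x xW].
rewrite disjoint_sym disjoint_subset; apply/subsetP=> w wW.
have [wR ww] := WR w wW; have wP := subsetP (sub_cover (RPP _ wR)) _ ww.
rewrite inE !in_setU !negb_or (disjointFl dL wP) /=; apply/andP; split.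
  apply/negP=> /bigcupP[Y /(subsetP R'R)/setDP[YR YB] wY].
  by case/negP: YB; rewrite -(def_pblock P_triv (RPP _ YR) wY) imset_f.
apply/negP=> /bigcupP[w' w'W /setD1P[ww' w'P]].
case/eqP: ww'; apply: Winj => //; have [w'R _] := WR _ w'W.
exact: def_pblock P_triv (RPP _ w'R) w'P.
Qed.

(** Each round absorbs p vertices of [L] and uses 2p cliques of [R], so both sides of the size
    condition drop by 6p. *)
Lemma absorb_pool R L : R \subset P -> L \subset X -> [disjoint L & cover P] ->
  2 * #|P| + 6 * #|L| + 6 * p + 3 * 2 ^ (p + q) <= 3 * #|R| ->
  exists2 L' : {set T}, L' \subset L &
    #|L'| < p /\ exists t, tiles b p t ((L :\: L') :|: cover R).
Proof.
have [n] := ubnP #|L|; elim: n R L => // n IHn R L cLn RP LX dL cR.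
have [Lp|pL] := ltnP #|L| p.
  exists L => //; split=> //; exists (2 * #|R|); rewrite setDv set0U.
  apply: pool_tiles (erefl) => //; first exact: trivIsetS RP P_triv.
  by move=> Y /(subsetP RP)/P_clique; rewrite mulnC.
have [L1 L1L cL1] := subset_of_card pL.
have [||||R1 [R1R cR1 [t1 tR1]]] := @absorb_step R L1 RP _ _ cL1.
- exact: subset_trans LX.
- exact: disjointWl dL.
- by clear -cR pL; setlia.
- by clear -cR; setlia.
have [|||||L' L'L [cL' [t tL']]] := IHn (R :\: R1) (L :\: L1).
- by rewrite cardsDS // cL1; clear -cLn p_gt0 pL; lia.
- by apply: subset_trans RP; apply: subsetDl.
- by apply: subset_trans LX; apply: subsetDl.
- by apply: disjointWl dL; apply: subsetDl.
- by rewrite !cardsDS // cR1 cL1; clear -cR pL; setlia.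
exists L'; first by by_elts.
split=> //; exists (t1 + t).
have covR : cover R = cover R1 :|: cover (R :\: R1).
  have eR : R1 :|: (R :\: R1) = R.
    by apply/setP=> Y; rewrite !inE; case YR1: (Y \in R1); rewrite //= (subsetP R1R).
  by rewrite -[in LHS]eR /cover bigcup_setU.
apply: tilesU_eq tR1 tL'; last by rewrite covR; by_elts.
have dRR : [disjoint cover R1 & cover (R :\: R1)].
  rewrite disjoint_subset; apply/subsetP=> x /bigcupP[Y YR1 xY]; apply/negP.
  case/bigcupP=> Z /setDP[ZR ZR1] xZ; case/negP: ZR1.
  rewrite -(def_pblock P_triv (subsetP RP _ ZR) xZ).
  by rewrite (def_pblock P_triv (subsetP RP _ (subsetP R1R _ YR1)) xY).
have sR (D : {set {set T}}) : D \subset R -> cover D \subset cover P.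
  by move=> QR; apply/bigcupsP=> Y /(subsetP QR)/(subsetP RP); apply: sub_cover.
have s1 := sR _ R1R; have s2 := sR _ (subsetDl R R1).
by by_elts.
Qed.

End Pool.

(** A greedy tiling by blue cliques of the double size 2p serves as the pool; its bounded leftover
    is then absorbed down to fewer than p vertices. *)
Lemma hub_tiles b p q X : 0 < p -> ~~ has_clique (~~ b) q X ->
  (forall x, x \in X -> 8 * #|X :&: nbh (~~ b) x| <= #|X|) ->
  31 * p * 2 ^ (2 * p + q) <= #|X| ->
  exists2 L : {set T}, L \subset X & #|L| < p /\ exists t, tiles b p t (X :\: L).
Proof.
move=> p0 nX dX cX.
have p20 : 0 < 2 * p by rewrite muln_gt0.
have [t [L LX [tX nL]]] := greedy_tiles c b X p20.
have [P [tP cP nP kP]] := tiles_pool p20 tX.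
have cL : #|L| < 2 ^ (2 * p + q).
  by apply: no_clique_bound nL _; apply: contra nX; apply: has_clique_sub.
have eX : #|X| = 2 * p * #|P| + #|L|.
  by rewrite nP -(tiles_card tX) cardsDS // subnK // subset_leq_card.
have K01 : 2 ^ (p + q) <= 2 ^ (2 * p + q) by rewrite leq_pexp2l //; lia.
have pK : p <= 2 ^ (p + q).
  by apply: leq_trans (ltnW (ltn_expl p (ltnSn 1))) _; rewrite leq_pexp2l // leq_addr.
set K0 := 2 ^ (p + q) in K01 pK; set K1 := 2 ^ (2 * p + q) in cX cL K01.
(* 15 = 6 + 6 + 3 are the coefficients of the slack in [absorb_pool], whose three terms are each at
   most [K1]. *)
have cPK : 15 * K1 <= #|P|.
  rewrite -(@leq_pmul2l (2 * p)) //.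
  have : K1 <= p * K1 by rewrite leq_pmull.
  clear -cX eX cL; set z := #|P| in eX *; lia.
have [||||L' L'L [cL' [s tL']]] := @absorb_pool b p q X P p0 nX dX tP _ kP _ P L (subxx _) LX.
- by rewrite cP subsetDl.
- rewrite eX; clear -cL cPK p0; set z := #|P| in cPK *; nia.
- by rewrite cP; by_elts.
- by rewrite -/K0; clear -cL cPK K01 pK; set z := #|P| in cPK *; lia.
exists L'; first exact: subset_trans LX.
split=> //; exists s; rewrite cP in tL'.
by have -> : X :\: L' = (L :\: L') :|: (X :\: L) by by_elts.
Qed.

End Hubs.

(** * Cliques of one colour versus tilings of the other *)

Section OffDiagonal.
Variables (T : finType) (c : {set T} -> bool).
Implicit Types (b : bool) (x y : T) (A B D H L Q S U V W X Y Z : {set T}).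
Local Notation edge := (edge c).
Local Notation nbh := (nbh c).
Local Notation clique := (clique c).
Local Notation has_clique := (has_clique c).
Local Notation tiles := (tiles c).
Local Notation packs := (packs c).

(** Every [u] in [L] is completed by p - 1 of its neighbours in [H]. The earlier choices block at
    most [p * #|L|] vertices, so at least 2^(p + q) neighbours are always left. *)
Lemma absorb_into b p q L H : 0 < p -> ~~ has_clique (~~ b) q H ->
  [disjoint L & H] ->
  (forall u, u \in L -> 2 ^ (p + q) + p * #|L| <= #|H :&: nbh b u|) ->
  exists2 H1 : {set T}, H1 \subset H & tiles b p #|L| (L :|: H1).
Proof.
move=> p0; have [n] := ubnP #|L|; elim: n L H => // n IHn L H cL nH dLH hL.
have [->|[u uL]] := set_0Vmem L.
  by exists set0; rewrite ?sub0set // cards0 set0U.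
have cLu : #|L| = (#|L :\ u|).+1 by rewrite (cardsD1 u) uL.
have : has_clique b p.-1 (H :&: nbh b u).
  have /orP[] := @erdos_szekeres _ c b p q (H :&: nbh b u) (leq_trans (leq_addr _ _) (hL u uL)).
    by apply: has_clique_leq; rewrite leq_pred.
  by move=> /(has_clique_sub (subsetIl _ _)); rewrite (negbTE nH).
case/has_cliqueP=> S [SN cS kS].
have SH : S \subset H := subset_trans SN (subsetIl _ _).
have uS : u \notin S by apply/negP=> /(subsetP SN); rewrite !inE edgexx andbF.
have cUS : #|u |: S| = p by rewrite cardsU1 uS cS; lia.
have [||||H1 H1H tH1] := IHn (L :\ u) (H :\: S).
- by lia.
- by apply: contra nH; apply: has_clique_sub; apply: subsetDl.
- by by_elts.
- move=> v /setD1P[_ vL].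
  have := hL v vL; rewrite cLu mulnS.
  have := cardsDS_leq (H :&: nbh b v) S.
  have -> : (H :&: nbh b v) :\: S = (H :\: S) :&: nbh b v by by_elts.
  by rewrite cS; lia.
exists (S :|: H1); first by by_elts.
rewrite cLu -add1n; apply: tilesU_eq (_ : tiles b p 1 (u |: S)) tH1; last first.
- apply: clique_tiles; last by rewrite muln1.
  by apply: cliqueU1 => //; apply: subset_trans SN (subsetIr _ _).
- apply/setP=> x; rewrite !inE; case: (eqVneq x u) => [->|_]; rewrite ?uL //=.
  by case: (x \in L); case: (x \in S).
have uH : u \notin H by rewrite (disjointFr dLH).
rewrite disjoint_subset; apply/subsetP=> x; rewrite !inE => /orP[/eqP->|xS].
  by rewrite eqxx /=; apply: contra uH => /(subsetP H1H)/setDP[].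
rewrite negb_or negb_and [x \in L](disjointFl dLH) ?(subsetP SH) // orbT.
by apply/negP=> /(subsetP H1H)/setDP[_]; rewrite xS.
Qed.

Lemma card_common_nbhN b A H m :
  (forall a, a \in A -> #|H :&: nbh b a| <= m) ->
  #|H| <= #|[set x in H | [forall a in A, ~~ edge b a x]]| + #|A| * m.
Proof.
move=> hA; set H2 := [set x in H | _].
have := cardsDS_leq H H2; rewrite addnC => h; apply: leq_trans h _.
rewrite leq_add2l -sum1_card.
apply: leq_trans (_ : \sum_(x in H :\: H2) #|A :&: nbh b x| <= _).
  apply: leq_sum => x /setDP[xH]; rewrite inE xH /= => /forall_inPn[a aA].
  rewrite negbK edgeC => ax; apply/card_gt0P; exists a; by rewrite !inE aA.
rewrite double_count -sum_nat_const; apply: leq_sum => a /hA; apply: leq_trans.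
by apply: subset_leq_card; apply: setSI; apply: subsetDl.
Qed.

(** [asym_size] is 16^q times [hub_size], the price of [exists_hub]. More than [link] neighbours in
    the hub allow [absorb_into] for a leftover of fewer than 2^(p + q) vertices, and [hub_size]
    exceeds 2^(p + q) times [link], so fewer than 2^(p + q) vertices of degree at most [link] do not
    exhaust a hub. *)
Definition hub_size p q := 2 ^ (3 * p + 2 * q + 6).
Definition asym_size p q := 2 ^ (3 * p + 6 * q + 6).
Definition link p q := p.+1 * 2 ^ (p + q).

(** [U'] collects the vertices outside the hub [H] with few blue neighbours in it. The other outside
    vertices are tiled greedily, their leftover is absorbed into [H] along [H1], and [hub_tiles]
    covers the rest of [H]. Hence only [L'] and fewer than p further vertices are missed. *)
Lemma hub_split b p q U : 0 < p -> ~~ has_clique (~~ b) q U ->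
  asym_size p q <= #|U| ->
  exists H U', [/\ H \subset U, U' \subset U :\: H, hub_size p q <= #|H|,
    forall u, u \in U' -> #|H :&: nbh b u| <= link p q &
    forall L' t', L' \subset U' -> tiles b p t' (U' :\: L') ->
      exists L t, [/\ L \subset U, #|L| < #|L'| + p & tiles b p t (U :\: L)]].
Proof.
move=> p0 nU cU.
have [|H HU [cH dH]] := @exists_hub _ c (~~ b) q (hub_size p q) U _ nU.
  apply: leq_trans cU; rewrite /hub_size /asym_size -[16]/(2 ^ 4) -expnM -expnD.
  by rewrite leq_exp2l //; lia.
pose U' := [set u in U :\: H | #|H :&: nbh b u| <= link p q].
have U'U : U' \subset U :\: H by apply/subsetP=> u; rewrite inE => /andP[].
have U'1 u : u \in U' -> #|H :&: nbh b u| <= link p q by rewrite inE => /andP[].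
have U'2 u : u \in (U :\: H) :\: U' -> link p q < #|H :&: nbh b u|.
  by move=> /setDP[uUH]; rewrite inE uUH -ltnNge.
clearbody U'; exists H, U'; split=> //.
move=> L' t' L'U' tU'.
have [t1 [L1 L1U [tL1 nL1]]] := greedy_tiles c b ((U :\: H) :\: U') p0.
have nH V : V \subset U -> ~~ has_clique (~~ b) q V.
  by move=> VU; apply: contra nU; apply: has_clique_sub.
have L1U' : L1 \subset U by by_elts.
have cL1 := no_clique_bound nL1 (nH _ L1U').
have dL1H : [disjoint L1 & H] by by_elts.
have pp : p < 2 ^ p by apply: ltn_expl.
have [|H1 H1H tH1] := absorb_into p0 (nH _ HU) dL1H.
  move=> u /(subsetP L1U)/U'2; rewrite /link; clear -cL1; nia.
have cH1 : #|H1| <= p * 2 ^ (p + q).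
  have := tiles_card tH1; have := subset_leq_card (subsetUr L1 H1).
  by clear -cL1; nia.
have eK : hub_size p q = 64 * (2 ^ p * (2 ^ p * 2 ^ (p + q) * 2 ^ q)).
  by rewrite /hub_size -[64]/(2 ^ 6) -!expnD; congr (2 ^ _); lia.
have K0 : 0 < 2 ^ (p + q) by rewrite expn_gt0.
have Kq : 0 < 2 ^ q by rewrite expn_gt0.
(* Twice the 31 of [hub_tiles], as [H1] may take up to half of the hub. *)
have big : 62 * (p * (2 ^ p * 2 ^ (p + q))) <= hub_size p q.
  rewrite eK; apply: leq_mul => //; apply: leq_mul; first exact: ltnW.
  by rewrite leq_pmulr.
have big2 : 62 * (p * 2 ^ (p + q)) <= hub_size p q.
  apply: leq_trans big; rewrite leq_mul2l leq_mul2l leq_pmull ?orbT //.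
  by rewrite expn_gt0.
(* Keeping half of the hub weakens its degree bound from 1/16 to the 1/8 required by [hub_tiles]. *)
have cHH1 : #|H| <= 2 * #|H :\: H1|.
  by rewrite cardsDS //; clear -cH1 big2 cH; lia.
have nHH1 := nH _ (subset_trans (subsetDl H H1) HU).
have [||L2 L2H [cL2 [t2 tL2]]] := hub_tiles p0 nHH1.
- move=> x /setDP[xH _]; have := dH x xH.
  have : #|(H :\: H1) :&: nbh (~~ b) x| <= #|H :&: nbh (~~ b) x|.
    by apply: subset_leq_card; by_elts.
  by clear -cHH1; lia.
- have -> : 2 * p + q = p + (p + q) by lia.
  by rewrite expnD; clear -cHH1 big cH; lia.
exists (L' :|: L2), (t1 + #|L1| + t2 + t').
split; first by by_elts.
  by rewrite (leq_ltn_trans (leq_card_setU _ _).1) // ltn_add2l.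
apply: (tilesU_eq (U := (((U :\: H) :\: U') :\: L1) :|: (L1 :|: H1) :|:
  ((H :\: H1) :\: L2)) _ _ _ tU').
- by by_elts.
- by by_elts.
apply: tilesU tL2; first by by_elts.
by apply: tilesU tH1; first by by_elts.
Qed.

(* [W] collects the final leftover and one blue (p-1)-clique per hub, all joined
   in red, so that it has no blue [K_p]. *)
Lemma asym_rec b p q U : 0 < p -> ~~ has_clique (~~ b) q U ->
  exists L W t, [/\ L \subset U, W \subset U, ~~ has_clique b p W, #|L| <= #|W| &
    tiles b p t (U :\: L)].
Proof.
move=> p0; have [n] := ubnP #|U|; elim: n U => // n IHn U cU nU.
have [sU|bU] := ltnP #|U| (asym_size p q).
  have [t [L LU [tL nL]]] := greedy_tiles c b U p0.
  by exists L, L, t.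
have [H [U' [HU U'U cH dU' hU]]] := hub_split p0 nU bU.
have K0 : 0 < 2 ^ (p + q) by rewrite expn_gt0.
have H0 : 0 < #|H| by apply: leq_trans cH; rewrite expn_gt0.
have U'U2 : U' \subset U := subset_trans U'U (subsetDl _ _).
have nV V : V \subset U -> ~~ has_clique (~~ b) q V.
  by move=> VU; apply: contra nU; apply: has_clique_sub.
have [||L' [W [t' [L'U' WU' nW cL' tU']]]] := IHn U'.
- have := subset_leq_card U'U; rewrite cardsDS //.
  by have := subset_leq_card HU; clear -cU H0; lia.
- exact: nV.
have [L [t [LU cL tL]]] := hU _ _ L'U' tU'.
have cW := no_clique_bound nW (nV _ (subset_trans WU' U'U2)).
(* The hub vertices joined in red to all of [W]; as every vertex of [W] has few blue neighbours in
   [H], enough of them remain to contain a blue (p-1)-clique [S]. *)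
set H2 := [set x in H | [forall a in W, ~~ edge b a x]].
have H2H : H2 \subset H by apply/subsetP=> x; rewrite inE => /andP[].
have cH2 : 2 ^ (p + q) <= #|H2|.
  have := @card_common_nbhN b W H (link p q) (fun a aW => dU' a (subsetP WU' a aW)).
  rewrite -/H2 /link => h; have := leq_trans cH h.
  have : p.+1 * 2 ^ (p + q) * 2 ^ (p + q) + 2 ^ (p + q) <= hub_size p q.
    have -> : hub_size p q = 64 * (2 ^ p * 2 ^ (p + q) * 2 ^ (p + q)).
      by rewrite /hub_size -[64]/(2 ^ 6) -!expnD; congr (2 ^ _); lia.
    have : p.+1 * 2 ^ (p + q) <= 2 ^ p * 2 ^ (p + q) by rewrite leq_mul2r ltn_expl ?orbT.
    by clear -K0; set x := 2 ^ (p + q) in K0 *; set y := 2 ^ p * x; nia.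
  by clear -cW; set x := 2 ^ (p + q) in cW *; set y := p.+1 * x; nia.
have : has_clique b p.-1 H2.
  have /orP[] := erdos_szekeres c b cH2.
    by apply: has_clique_leq; rewrite leq_pred.
  by rewrite (negbTE (nV _ (subset_trans H2H HU))).
case/has_cliqueP=> S [SH2 cS kS].
have SH := subset_trans SH2 H2H.
have dWS : [disjoint W & S] by by_elts.
exists L, (W :|: S), t; split=> //; first by by_elts.
(* All edges between [W] and [S] are red, so a blue p-clique lies on one side; but [W] has none and
   [S] has only p - 1 vertices. *)
- apply/negP=> /has_cliqueP[Q [QWS cQ kQ]].
  have WS w s : w \in Q -> s \in Q -> w \in W -> s \in S -> False.
    move=> wQ sQ wW sS; have ws : w != s by apply: contraTneq wW => ->; rewrite (disjointFl dWS).
    have := cliqueP _ _ _ kQ _ _ wQ sQ ws.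
    by have := subsetP SH2 _ sS; rewrite inE => /andP[_ /forall_inP/(_ w wW)/negbTE->].
  have [QS0|[s]] := set_0Vmem (Q :&: S).
    case/negP: nW; apply/has_cliqueP; exists Q; split=> //.
    apply/subsetP=> x xQ; have := subsetP QWS _ xQ; rewrite inE => /orP[//|xS].
    by have : x \in Q :&: S by [rewrite inE xQ]; rewrite QS0 inE.
  case/setIP=> sQ sS; have QS : Q \subset S.
    apply/subsetP=> x xQ; have := subsetP QWS _ xQ; rewrite inE => /orP[xW|//].
    by have := WS x s xQ sQ xW sS.
  by have := subset_leq_card QS; rewrite cQ cS; clear -p0; lia.
rewrite cardsU (disjoint_setI0 dWS) cards0 subn0 cS.
by clear -cL cL' p0; lia.
Qed.

(* The bound r(K_(q+1), nK_p) <= pn + r(K_q, K_p) - 1, with [rho] = r(K_q, K_p). *)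
Lemma packs_asym b p q rho n D : 0 < p -> ~~ has_clique (~~ b) q.+1 D ->
  (forall W, W \subset D -> rho <= #|W| -> has_clique b p W || has_clique (~~ b) q W) ->
  asym_size p q.+1 <= #|D| -> p * n + rho <= #|D|.+1 -> packs b p n D.
Proof.
move=> p0 nD hrho sD cD.
have [H [U' [HU U'U cH dU' hU]]] := hub_split p0 nD sD.
have U'D : U' \subset D := subset_trans U'U (subsetDl _ _).
have nV V : V \subset D -> ~~ has_clique (~~ b) q.+1 V.
  by move=> VU; apply: contra nD; apply: has_clique_sub.
have [L' [W [t' [L'U' WU' nW cL' tU']]]] := asym_rec p0 (nV _ U'D).
have [L [t [LU cL tL]]] := hU _ _ L'U' tU'.
have WD := subset_trans WU' U'D.
have cW := no_clique_bound nW (nV _ WD).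
have K0 : 0 < 2 ^ (p + q.+1) by rewrite expn_gt0.
have [x] : exists x, x \in [set x in H | [forall a in W, ~~ edge b a x]].
  apply/card_gt0P.
  have := @card_common_nbhN b W H (link p q.+1) (fun a aW => dU' a (subsetP WU' a aW)).
  rewrite /link => h; have := leq_trans cH h.
  have : p.+1 * 2 ^ (p + q.+1) * 2 ^ (p + q.+1) + 1 <= hub_size p q.+1.
    have -> : hub_size p q.+1 = 64 * (2 ^ p * 2 ^ (p + q.+1) * 2 ^ (p + q.+1)).
      by rewrite /hub_size -[64]/(2 ^ 6) -!expnD; congr (2 ^ _); lia.
    have : p.+1 * 2 ^ (p + q.+1) <= 2 ^ p * 2 ^ (p + q.+1) by rewrite leq_mul2r ltn_expl ?orbT.
    by clear -K0; set x := 2 ^ (p + q.+1) in K0 *; set y := 2 ^ p * x; nia.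
  by clear -cW; set x := 2 ^ (p + q.+1) in cW *; set y := p.+1 * x; nia.
rewrite inE => /andP[xH /forall_inP xW].
(* A red q-clique in [W] would be extended by the hub vertex [x]. *)
have nWq : ~~ has_clique (~~ b) q W.
  apply: contra (nV (x |: W) _) => [h|]; last first.
    by rewrite subUset sub1set (subsetP HU).
  apply: has_cliqueS (setU11 x W) _; apply: has_clique_sub h.
  apply/subsetP=> w wW; rewrite !inE wW orbT /= edgeN 1?edgeC ?xW //.
  by apply: contraTneq xH => ->; have /setDP[] := subsetP U'U _ (subsetP WU' _ wW).
have rW : #|W| < rho.
  by rewrite ltnNge; apply/negP=> /(hrho W WD); rewrite (negbTE nW) (negbTE nWq).
apply: (@packs_leq _ _ _ _ t); last by exists (D :\: L); first exact: subsetDl.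
have := tiles_card tL; rewrite cardsDS //; have := subset_leq_card LU.
(* The leftover [L] has at most rho + p - 2 vertices, so the shortfall against [p * n] is below p
   and divisibility gives n <= t. *)
move=> h1 h2; have : p * n < p * t.+1 by rewrite mulnS; clear -cD cL cL' rW h1 h2 p0; lia.
by rewrite ltn_mul2l => /andP[].
Qed.

End OffDiagonal.

(** * Structure of colourings with few disjoint monochromatic cliques *)

Lemma pigeonhole_fiber (T T' : finType) (f : T -> T') (B : {set T}) (D : {set T'}) :
  B != set0 -> (forall y, y \in B -> f y \in D) ->
  exists2 d, d \in D & #|B| <= #|D| * #|[set y in B | f y == d]|.
Proof.
move=> B0 fD; apply/exists_inP; apply: contraT; rewrite negb_exists_in => /forall_inP h.
have eB : #|B| = \sum_(d in D) #|[set y in B | f y == d]|.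
  rewrite -sum1_card (partition_big f [in D]) //=; apply: eq_bigr => d _.
  by rewrite -sum1_card; apply: eq_bigl => y; rewrite inE.
have [y yB] := set0Pn _ B0; have D0 : 0 < #|D| by apply/card_gt0P; exists (f y); apply: fD.
have : \sum_(d in D) (1 + #|D| * #|[set y in B | f y == d]|) <= \sum_(d in D) #|B|.
  by apply: leq_sum => d dD; rewrite add1n ltnNge h.
by rewrite big_split /= sum1_card -big_distrr /= -eB sum_nat_const; lia.
Qed.

Section Core.
Variables (T : finType) (c : {set T} -> bool).
Implicit Types (b : bool) (x y : T) (A B D H L Q S U V W X Y Z : {set T}).
Local Notation edge := (edge c).
Local Notation nbh := (nbh c).
Local Notation clique := (clique c).
Local Notation has_clique := (has_clique c).
Local Notation packs := (packs c).

(** By averaging: the vertices of [B] of low degree account for at most half of the edges counted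
    from [A]. *)
Lemma many_rich b A B m : A != set0 ->
  (forall a, a \in A -> #|B| <= m * #|B :&: nbh b a|) ->
  #|B| <= 2 * m * #|[set y in B | #|A| <= 2 * m * #|A :&: nbh b y|]|.
Proof.
rewrite -card_gt0 => A0 hA; set B1 := [set y in B | _].
have : #|A| * #|B| <= m * \sum_(a in A) #|B :&: nbh b a|.
  by rewrite big_distrr /= -sum_nat_const; apply: leq_sum.
rewrite double_count => h.
have : 2 * m * \sum_(y in B) #|A :&: nbh b y| <= 2 * m * #|A| * #|B1| + #|A| * #|B|.
  have B1B : B1 \subset B by apply/subsetP=> y; rewrite inE => /andP[].
  rewrite (big_setID B1) /= (setIidPr B1B) mulnDr; apply: leq_add.
    rewrite -[X in _ <= X]mulnA leq_mul2l; apply/orP; right; rewrite mulnC -sum_nat_const.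
    by apply: leq_sum => y _; apply: subset_leq_card; apply: subsetIl.
  rewrite big_distrr /=.
  apply: leq_trans (_ : \sum_(y in B :\: B1) #|A| <= _).
    apply: leq_sum => y /setDP[yB]; rewrite inE yB /= -ltnNge; exact: ltnW.
  rewrite sum_nat_const mulnC leq_mul2l; apply/orP; right.
  by apply: subset_leq_card; apply: subsetDl.
move=> h2; rewrite -(@leq_pmul2l #|A|) //.
clear -h h2; set z := \sum_(y in B) _ in h h2 *; nia.
Qed.

(** The 3k vertices of [A] leave room to choose two disjoint (k-1)-sets avoiding a given k-clique,
    as in [no_blue_pair]. *)
Definition core b k s V A B :=
  [/\ A \subset V, B \subset V, clique b A, #|A| = 3 * k &
   [/\ ~~ has_clique b k B, s <= #|B|,
       forall x, x \in B -> 16 * #|B :&: nbh b x| <= #|B| &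
       forall a x, a \in A -> x \in B -> edge (~~ b) a x]].

(** [A] contains a [b]-clique [A1] of size 24k. An eighth of [B] sees at least an eighth of [A1],
    that is 3k vertices, in the other colour; pigeonhole over the 2^(24k) subsets of [A1] fixes one
    such 3k-set for many vertices of [B]. A hub among these costs the last factor 16^k. *)
Lemma core_half b k s A B : 0 < k -> 0 < s ->
  ~~ has_clique (~~ b) k A -> ~~ has_clique b k B ->
  (forall a, a \in A -> #|B| <= 4 * #|B :&: nbh (~~ b) a|) ->
  2 ^ (25 * k) <= #|A| -> s * 2 ^ (28 * k + 3) <= #|B| ->
  exists A' B', core b k s (A :|: B) A' B'.
Proof.
move=> k0 s0 nA nB hA cA cB.
have : has_clique b (24 * k) A.
  have /orP[//|] := @erdos_szekeres _ c b (24 * k) k A ltac:(by rewrite -mulSnr).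
  by rewrite (negbTE nA).
case/has_cliqueP=> A1 [A1A cA1 kA1].
have A10 : A1 != set0 by rewrite -card_gt0 cA1 muln_gt0.
have := @many_rich (~~ b) A1 B 4 A10 (fun a aA1 => hA a (subsetP A1A a aA1)).
set B1 := [set y in B | _] => cB1.
pose f y := odflt set0 [pick S : {set T} | (S \subset A1 :&: nbh (~~ b) y) && (#|S| == 3 * k)].
have fP y : y \in B1 -> f y \subset A1 :&: nbh (~~ b) y /\ #|f y| = 3 * k.
  rewrite inE cA1 => /andP[_ h]; rewrite /f; case: pickP => [S /andP[? /eqP?]//|].
  have [|S SA cS] := @subset_of_card _ (A1 :&: nbh (~~ b) y) (3 * k).
    by clear -h; lia.
  by move=> /(_ S); rewrite SA cS eqxx.
have s2 : 0 < s * 2 ^ (28 * k + 3) by rewrite muln_gt0 s0 expn_gt0.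
have B10 : B1 != set0.
  by rewrite -card_gt0; clear -cB1 s2 cB; lia.
have [|A' A'A1 cB2] := @pigeonhole_fiber _ _ f B1 (powerset A1) B10.
  by move=> y /fP[fA _]; rewrite inE (subset_trans fA) // subsetIl.
rewrite inE in A'A1; rewrite card_powerset cA1 in cB2.
set B2 := [set y in B1 | _] in cB2.
have B2B : B2 \subset B by apply/subsetP=> y; rewrite !inE => /andP[/andP[]].
have nB2 : ~~ has_clique b k B2 by apply: contra nB; apply: has_clique_sub.
have [|B' B'B2 [cB' dB']] := exists_hub (s := s) _ nB2.
  rewrite -(@leq_pmul2l (8 * 2 ^ (24 * k))); last by rewrite muln_gt0 expn_gt0.
  apply: leq_trans (_ : s * 2 ^ (28 * k + 3) <= _).
    rewrite -[16]/(2 ^ 4) -[8]/(2 ^ 3) -expnM mulnCA -!expnD leq_mul2l leq_exp2l //.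
    by apply/orP; right; clear; lia.
  by clear -cB cB1 cB2; lia.
have hB2 y : y \in B' -> A' \subset A1 :&: nbh (~~ b) y /\ #|A'| = 3 * k.
  move=> /(subsetP B'B2); rewrite inE => /andP[yB1 /eqP<-]; exact: fP.
exists A', B'; split.
- exact: subset_trans (subset_trans A'A1 A1A) (subsetUl _ _).
- exact: subset_trans (subset_trans B'B2 B2B) (subsetUr _ _).
- exact: sub_clique kA1.
- have [y yB] : exists y, y \in B' by apply/card_gt0P; apply: leq_trans cB'.
  by have [] := hB2 y yB.
split=> //; first by apply: contra nB2; apply: has_clique_sub.
move=> a x aA /hB2[/subsetP/(_ a aA)]; rewrite !inE => /andP[_ +] _.
by rewrite edgeC.
Qed.

Lemma core_sub b k s V V' A B : V \subset V' -> core b k s V A B -> core b k s V' A B.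
Proof. by move=> sV [AV BV ? ? ?]; split=> //; apply: subset_trans sV. Qed.

(** If half of [A] sees half of [B] in colour [false], [core_half] applies directly. Otherwise half
    of [A] sees half of [B] in colour [true], and by [many_rich] it applies with the two sides and
    the colours exchanged. *)
Lemma exists_core k s A B : 0 < k -> 0 < s -> [disjoint A & B] ->
  ~~ has_clique false k A -> ~~ has_clique true k B ->
  s * 2 ^ (28 * k + 5) <= #|A| -> s * 2 ^ (28 * k + 5) <= #|B| ->
  exists b A' B', core b k s (A :|: B) A' B'.
Proof.
move=> k0 s0 dAB nA nB cA cB.
have e5 : 2 ^ (28 * k + 5) = 4 * 2 ^ (28 * k + 3).
  by rewrite -[4]/(2 ^ 2) -expnD; congr (2 ^ _); lia.
have e25 : 2 ^ (25 * k) <= s * 2 ^ (28 * k + 3).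
  apply: leq_trans (_ : 2 ^ (28 * k + 3) <= _); first by rewrite leq_exp2l //; lia.
  by rewrite leq_pmull.
rewrite e5 in cA cB.
pose A1 := [set a in A | #|B| <= 2 * #|B :&: nbh false a|].
have A1A : A1 \subset A by apply/subsetP=> a; rewrite inE => /andP[].
have cAA : #|A| = #|A1| + #|A :\: A1|.
  by rewrite cardsDS // subnKC // subset_leq_card.
have [le|gt] := leqP #|A| (2 * #|A1|).
  have nA1 : ~~ has_clique (~~ true) k A1 by apply: contra nA; apply: has_clique_sub.
  have [|||A' [B' h]] := core_half k0 s0 nA1 nB.
  - by move=> a; rewrite inE => /andP[_] /=; lia.
  - by clear -cA e25 le; lia.
  - by clear -cB; lia.
  - by exists true, A', B'; apply: core_sub h; apply: setSU.
pose A2 := A :\: A1.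
have dA2 a : a \in A2 -> #|B| <= 2 * #|B :&: nbh true a|.
  move=> /setDP[aA]; rewrite inE aA /= -ltnNge.
  by have := card_nbh_split c true a B; rewrite (disjointFr dAB aA) /=; lia.
have cA2 : s * (2 * 2 ^ (28 * k + 3)) <= #|A2| by rewrite /A2; clear -cA cAA gt; lia.
have A20 : A2 != set0.
  rewrite -card_gt0; apply: leq_trans cA2; by rewrite !muln_gt0 s0 expn_gt0.
have := @many_rich true A2 B 2 A20 dA2; set B1 := [set y in B | _] => cB1.
have B1B : B1 \subset B by apply/subsetP=> y; rewrite inE => /andP[].
have [|||||A' [B' h]] := @core_half false k s B1 A2 k0 s0.
- by apply: contra nB; apply: has_clique_sub.
- by apply: contra nA; apply: has_clique_sub; apply: subsetDl.
- by move=> y; rewrite inE => /andP[_].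
- by clear -cB cB1 e25; lia.
- by clear -cA2; lia.
exists false, A', B'; apply: core_sub h.
by rewrite setUC; apply: setUSS => //; apply: subsetDl.
Qed.

(** Discarding at most n disjoint cliques of each colour leaves [W] and [W'], each free of one
    colour. Their intersection is small, so the two differences are large and disjoint. *)
Lemma packs_or_core k s n V : 0 < k -> 0 < s ->
  k * n + (s * 2 ^ (28 * k + 5) + 2 ^ (2 * k)) <= #|V| ->
  [\/ packs true k n.+1 V, packs false k n.+1 V |
      exists b A B, core b k s V A B].
Proof.
move=> k0 s0 cV.
have [p1|[W WV [nW cW]]] := packs_or_free c true k n V; first by constructor 1.
have [p2|[W' W'V [nW' cW']]] := packs_or_free c false k n V; first by constructor 2.
constructor 3.
have cI : #|W :&: W'| < 2 ^ (2 * k).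
  rewrite mul2n -addnn; apply: (@no_clique_bound _ c true).
    by apply: contra nW; apply: has_clique_sub; apply: subsetIl.
  by apply: contra nW'; apply: has_clique_sub; apply: subsetIr.
have [|||||b [A' [B' h]]] := @exists_core k s (W' :\: W) (W :\: W') k0 s0.
- by by_elts.
- by apply: contra nW'; apply: has_clique_sub; apply: subsetDl.
- by apply: contra nW; apply: has_clique_sub; apply: subsetDl.
- have := cardsD W' W; have := subset_leq_card (subsetIl W' W).
  by rewrite setIC; clear -cI cW' cV; lia.
- have := cardsD W W'; have := subset_leq_card (subsetIl W W').
  by clear -cI cW cV; lia.
exists b, A', B'; apply: core_sub h.
by rewrite subUset !(subset_trans (subsetDl _ _)).
Qed.

Lemma clique_through b k (A : {set T}) a : clique b A -> a \in A -> 0 < k <= #|A| ->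
  exists Q, [/\ Q \subset A, #|Q| = k, clique b Q & a \in Q].
Proof.
move=> kA aA /andP[k0 cA].
have [|S SA cS] := @subset_of_card _ (A :\ a) k.-1.
  by rewrite (cardsD1 a) aA in cA; lia.
have QA : a |: S \subset A by rewrite subUset sub1set aA (subset_trans SA) // subsetDl.
exists (a |: S); split; rewrite ?setU11 //; last exact: sub_clique kA.
have : a \notin S by apply/negP=> /(subsetP SA); rewrite !inE eqxx.
by rewrite cardsU1 cS => ->; lia.
Qed.

(* Removes one red and one blue [K_k] with a common vertex at a time. *)
Lemma packs_weak k s n V : 0 < k -> 2 ^ (2 * k) <= s ->
  (2 * k - 1) * n + (s * 2 ^ (28 * k + 5) + 2 ^ (2 * k)) <= #|V| ->
  packs true k n V \/ packs false k n V.
Proof.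
move=> k0 Ks; have s0 : 0 < s by apply: leq_trans Ks; rewrite expn_gt0.
elim: n V => [|n IHn] V cV; first by left; exists set0; rewrite ?sub0set.
have [h|h|[b [A [B [AV BV kA cA [nB cB _ hAB]]]]]] :=
  @packs_or_core k s n V k0 s0 ltac:(move: cV; clear -k0; set M := s * _ + _; nia);
  [by left|by right|].
have [a aA] : exists a, a \in A by apply/card_gt0P; rewrite cA muln_gt0.
have [|Q [QA cQ kQ aQ]] := clique_through (k := k) kA aA; first by rewrite cA k0; lia.
have : has_clique (~~ b) k.-1 B.
  have := @erdos_szekeres _ c b k k B; rewrite addnn -mul2n (negbTE nB) /=.
  move=> /(_ (leq_trans Ks cB)); apply: has_clique_leq; exact: leq_pred.
case/has_cliqueP=> S [SB cS kS].
have aN : S \subset nbh (~~ b) a.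
  by apply/subsetP=> x /(subsetP SB) xB; rewrite nbhE; apply: hAB.
have aS : a \notin S by apply/negP=> /(subsetP aN); rewrite nbhE edgexx.
have cP : #|a |: S| = k by rewrite cardsU1 aS cS; clear -k0; lia.
have kP := cliqueU1 aN kS.
have PV : a |: S \subset V.
  by rewrite subUset sub1set (subsetP AV) // (subset_trans SB).
have cQP : #|Q :|: (a |: S)| <= 2 * k - 1.
  have : 0 < #|Q :&: (a |: S)| by apply/card_gt0P; exists a; rewrite inE aQ setU11.
  by have := cardsUI Q (a |: S); rewrite cQ cP; clear; lia.
have [|h|h] := IHn (V :\: (Q :|: (a |: S))).
- have := cardsDS_leq V (Q :|: (a |: S)); rewrite mulnS in cV.
  by clear -cV cQP; lia.
- case: b {kA hAB nB aN} kQ kS kP h => [kQ _ _ h|_ _ kP h]; left.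
    apply: packsS (subset_trans QA AV) cQ kQ _; apply: packs_sub h.
    by apply: setDS; apply: subsetUl.
  by apply: packsS PV cP kP _; apply: packs_sub h; apply: setDS; apply: subsetUr.
- case: b {kA hAB nB aN} kQ kS kP h => [_ _ kP h|kQ _ _ h]; right.
    by apply: packsS PV cP kP _; apply: packs_sub h; apply: setDS; apply: subsetUr.
  apply: packsS (subset_trans QA AV) cQ kQ _; apply: packs_sub h.
    by apply: setDS; apply: subsetUl.
Qed.

(** A p-clique of [D] excludes at most [p * m] vertices of [A]; the term [n] pays for the vertices
    given to the other cliques. *)
Lemma packs_extend b p m n D A : [disjoint D & A] ->
  (forall v, v \in D -> #|A :&: nbh (~~ b) v| <= m) -> n + p * m <= #|A| ->
  packs b p n D -> packs b p.+1 n (D :|: A).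
Proof.
elim: n D A => [|n IHn] D A dDA hD cA; first by exists set0; rewrite ?sub0set.
case=> V VD /= [S [SV cS kS tV]].
have SD := subset_trans SV VD.
have := @card_common_nbhN _ c (~~ b) S A m (fun v vS => hD v (subsetP SD v vS)).
rewrite cS => h.
have [a] : exists a, a \in [set x in A | [forall v in S, ~~ edge (~~ b) v x]].
  by apply/card_gt0P; clear -h cA; lia.
rewrite inE => /andP[aA /forall_inP aS].
have dSa v : v \in S -> v != a.
  by move=> /(subsetP SD) vD; apply: contraTneq vD => ->; rewrite (disjointFl dDA).
have aN : S \subset nbh b a.
  by apply/subsetP=> v vS; rewrite nbhE edgeC -[b]negbK edgeN ?aS ?dSa.
have nS : a \notin S by apply/negP=> /dSa; rewrite eqxx.
apply: (@packsS _ _ _ _ _ (a |: S)).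
- by rewrite subUset sub1set inE aA orbT /=; by_elts.
- by rewrite cardsU1 nS cS.
- exact: cliqueU1.
apply: packs_sub (IHn (D :\: S) (A :\ a) _ _ _ _).
- rewrite subUset; apply/andP; split.
    apply/subsetP=> v /setDP[vD vS]; rewrite !inE vD (negbTE vS) orbF /= andbT.
    by apply: contraTneq vD => ->; rewrite (disjointFl dDA).
  apply/subsetP=> v /setD1P[va vA]; rewrite !inE vA (negbTE va) orbT andbT /=.
  by apply/negP=> /(subsetP SD) vD; rewrite (disjointFl dDA) in vD.
- by by_elts.
- move=> v /setDP[vD _]; apply: leq_trans (hD v vD).
  by apply: subset_leq_card; apply: setSI; apply: subsetDl.
- by have := cardsD1 a A; rewrite aA; clear -cA; lia.
- by exists (V :\: S) => //; apply: setSD.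
Qed.

End Core.

(** * Colourings without gadgets *)

Section Gadgets.
Variables (T : finType) (c : {set T} -> bool).
Implicit Types (b : bool) (x y : T) (A B D F H L P Q S U V W X Y Z : {set T}).
Local Notation clique := (clique c).
Local Notation packs := (packs c).

Definition kclique b k V Q := [&& Q \subset V, #|Q| == k & clique b Q].

(* Removing a gadget decreases n by 2 for less than the 2(2k-1) vertices available. *)
Definition gadget k V := exists b Q1 Q2 P1 P2,
  [/\ kclique b k V Q1 && kclique b k V Q2,
      kclique (~~ b) k V P1 && kclique (~~ b) k V P2,
      [disjoint Q1 & Q2], [disjoint P1 & P2] &
      #|(Q1 :|: Q2) :|: (P1 :|: P2)| <= 4 * k - 3].

Lemma packs_gadget k n V : gadget k V ->
  (forall U, U \subset V -> #|V| <= #|U| + (4 * k - 3) ->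
     packs true k n U \/ packs false k n U) ->
  packs true k n.+2 V \/ packs false k n.+2 V.
Proof.
case=> b [Q1 [Q2 [P1 [P2 [/andP[q1 q2] /andP[p1 p2] dQ dP cG]]]]] h.
have ext b' R1 R2 U : kclique b' k V R1 -> kclique b' k V R2 -> [disjoint R1 & R2] ->
    U \subset V :\: (R1 :|: R2) -> packs b' k n U -> packs b' k n.+2 V.
  move=> /and3P[s1 /eqP c1 k1] /and3P[s2 /eqP c2 k2] d sU pU.
  apply: packsS s1 c1 k1 _; apply: packsS (_ : R2 \subset _) c2 k2 _; first by by_elts.
  by apply: packs_sub pU; rewrite setDDl.
have [|| pU | pU] := h (V :\: ((Q1 :|: Q2) :|: (P1 :|: P2))).
- exact: subsetDl.
- by have := cardsDS_leq V ((Q1 :|: Q2) :|: (P1 :|: P2)); clear -cG; lia.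
- case: b q1 q2 p1 p2 => q1 q2 p1 p2; left; [apply: ext q1 q2 dQ _ pU|apply: ext p1 p2 dP _ pU];
    by apply: setDS; rewrite ?subsetUl ?subsetUr.
- case: b q1 q2 p1 p2 => q1 q2 p1 p2; right; [apply: ext p1 p2 dP _ pU|apply: ext q1 q2 dQ _ pU];
    by apply: setDS; rewrite ?subsetUl ?subsetUr.
Qed.

(* The cliques meet as a path Q1 - P1 - Q2 - P2, which saves three vertices. *)
Lemma gadget_of_path b k V Q1 Q2 P1 P2 x1 x2 x3 :
  kclique b k V Q1 -> kclique b k V Q2 -> kclique (~~ b) k V P1 -> kclique (~~ b) k V P2 ->
  [disjoint Q1 & Q2] -> [disjoint P1 & P2] ->
  x1 \in P1 :&: Q1 -> x2 \in P1 :&: Q2 -> x3 \in P2 :&: Q2 -> gadget k V.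
Proof.
move=> q1 q2 p1 p2 dQ dP /setIP[xP1 xQ1] /setIP[xP2 xQ2] /setIP[xP3 xQ3].
exists b, Q1, Q2, P1, P2; split; rewrite ?q1 ?q2 ?p1 ?p2 //.
case/and3P: q1 => _ /eqP c1 _; case/and3P: q2 => _ /eqP c2 _.
case/and3P: p1 => _ /eqP c3 _; case/and3P: p2 => _ /eqP c4 _.
have cQ : #|Q1 :|: Q2| = 2 * k.
  by rewrite cardsU (disjoint_setI0 dQ) cards0 subn0 c1 c2 mul2n addnn.
have cP : #|P1 :|: P2| = 2 * k.
  by rewrite cardsU (disjoint_setI0 dP) cards0 subn0 c3 c4 mul2n addnn.
have x12 : x1 != x2 by apply: contraTneq xQ1 => ->; rewrite (disjointFl dQ).
have x13 : x1 != x3 by apply: contraTneq xQ1 => ->; rewrite (disjointFl dQ).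
have x23 : x2 != x3 by apply: contraTneq xP2 => ->; rewrite (disjointFl dP).
have cI : 3 <= #|(Q1 :|: Q2) :&: (P1 :|: P2)|.
  rewrite -[3](_ : #|[set x1; x2; x3]| = 3); last first.
    by rewrite setUC cardsU1 cards2 !inE negb_or x12 eq_sym x13 eq_sym x23.
  apply: subset_leq_card; apply/subsetP=> x; rewrite !inE -orbA.
  by case/or3P=> /eqP->; rewrite ?xP1 ?xP2 ?xP3 ?xQ1 ?xQ2 ?xQ3 ?orbT.
by have := cardsUI (Q1 :|: Q2) (P1 :|: P2); rewrite cQ cP; clear -cI; lia.
Qed.

End Gadgets.

(* Below, "red" is the colour [b] and "blue" the other one. *)
Section NoGadget.
Variables (T : finType) (c : {set T} -> bool) (b : bool) (k : nat) (V A1 B : {set T}).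
Implicit Types (x y v a : T) (A D F H L N P Q S U W X Y Z : {set T}).
Local Notation edge := (edge c).
Local Notation nbh := (nbh c).
Local Notation clique := (clique c).
Local Notation has_clique := (has_clique c).
Local Notation packs := (packs c).
Local Notation kclique := (kclique c).

Hypotheses (k_gt1 : 1 < k) (noG : ~ gadget c k V).
Hypothesis coreAB : core c b k (2 ^ (3 * k + 4)) V A1 B.

Let K := 2 ^ (2 * k).

Let K_gt : 4 * k <= 2 * K.
Proof.
have : k < 2 ^ k by apply: ltn_expl.
have : 2 ^ k * 2 ^ k = K by rewrite -expnD addnn -mul2n.
by clear -k_gt1; nia.
Qed.

Let B_large : 16 * k * K <= #|B|.
Proof.
case: coreAB => _ _ _ _ [_ + _ _]; apply: leq_trans.
have -> : 3 * k + 4 = 4 + k + 2 * k by lia.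
by rewrite /K !expnD -[16]/(2 ^ 4) leq_mul2r leq_mul2l (ltnW (ltn_expl k _)) ?orbT.
Qed.

Let B_blue m N : N \subset B -> K <= #|N| -> m <= k ->
  exists S, [/\ S \subset N, #|S| = m & clique (~~ b) S].
Proof.
move=> NB cN mk; case: coreAB => _ _ _ _ [nB _ _ _]; apply/has_cliqueP.
have /orP[h|] := @erdos_szekeres _ c b k k N ltac:(by rewrite addnn -mul2n).
  by case/negP: nB; apply: has_clique_sub h.
exact: has_clique_leq.
Qed.

(** The tolerance 1/(4k) is half of the fraction 1/(2k) of [no_red_clique_at]: a vertex that is blue
    to 1/(2k) of [B] shares blue neighbours in [B] with every vertex of a good set. *)
Let good A := [&& A1 \subset A, A \subset V, clique b A &
  [forall a in A, 4 * k * #|B :&: nbh b a| <= #|B|]].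

Variable A0 : {set T}.
Hypothesis A0max : maxset good A0.

Let A0good : [/\ A1 \subset A0, A0 \subset V, clique b A0 &
  forall a, a \in A0 -> 4 * k * #|B :&: nbh b a| <= #|B|].
Proof. by have /and4P[? ? ? /forall_inP ?] := maxsetp A0max. Qed.

Let B_sub : B \subset V. Proof. by case: coreAB. Qed.

Let A0_large : 3 * k <= #|A0|.
Proof.
case: coreAB => _ _ _ <- _; apply: subset_leq_card; by case: A0good.
Qed.

Let B_large32 : 32 * K <= #|B|.
Proof. by apply: leq_trans B_large; rewrite leq_mul2r; clear -k_gt1; lia. Qed.

Let ext_blue a F : a \in A0 -> #|F| <= k -> a \notin F ->
  exists P, [/\ kclique (~~ b) k V P, a \in P & [disjoint P & F]].
Proof.
move=> aA cF aF; have [_ A0V _ /(_ a aA) dB] := A0good.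
have [|||S [SN cS kS]] := @B_blue k.-1 ((B :&: nbh (~~ b) a) :\: F).
- exact: subset_trans (subsetDl _ _) (subsetIl _ _).
- have := cardsDS_leq (B :&: nbh (~~ b) a) F; have := card_nbh_split c b a B.
  have : (a \in B) <= 1 by case: (a \in B).
  have : 8 * #|B :&: nbh b a| <= #|B|.
    apply: leq_trans dB; rewrite leq_mul2r; clear -k_gt1; lia.
  by clear -cF B_large32 K_gt k_gt1; lia.
- exact: leq_pred.
have SNb : S \subset nbh (~~ b) a by clear -SN; by_elts.
have SF : [disjoint S & F] by clear -SN; by_elts.
have SV : S \subset V by apply: subset_trans B_sub; clear -SN; by_elts.
have aS : a \notin S by apply/negP=> /(subsetP SNb); rewrite nbhE edgexx.
exists (a |: S); split; rewrite ?setU11 //.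
  apply/and3P; split; last exact: cliqueU1.
    by rewrite subUset sub1set (subsetP A0V).
  by rewrite cardsU1 aS cS; clear -k_gt1; lia.
rewrite disjoint_subset; apply/subsetP=> x; rewrite !inE => /orP[/eqP->//|xS].
by rewrite (disjointFr SF xS).
Qed.

(** Otherwise [v1] and [v2] extend to disjoint red k-cliques through [A0], and a vertex of [A0] in
    the second lies in a blue k-clique avoiding [P] by [ext_blue]: this is the path of a gadget with
    [P] in the middle. *)
Let no_blue_pair P v1 v2 : kclique (~~ b) k V P -> v1 \in P -> v2 \in P -> v1 != v2 ->
  3 * k <= #|A0 :&: nbh b v1| -> 3 * k <= #|A0 :&: nbh b v2| -> False.
Proof.
move=> hP v1P v2P v12 d1 d2; have [_ A0V kA0 _] := A0good.
have /and3P[PV /eqP cP _] := hP.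
have mk v F : v \in P -> P \subset F -> #|F| <= 2 * k -> 3 * k <= #|A0 :&: nbh b v| ->
    exists S, [/\ S \subset A0 :\: F, #|S| = k.-1 & kclique b k V (v |: S)].
  move=> vP PF cF dv.
  have [|S SA cS] := @subset_of_card _ ((A0 :&: nbh b v) :\: F) k.-1.
    by have := cardsDS_leq (A0 :&: nbh b v) F; clear -cF dv k_gt1; lia.
  exists S; split=> //; first by clear -SA; by_elts.
  have vS : v \notin S.
    by apply/negP=> /(subsetP SA); rewrite !inE edgexx !andbF.
  apply/and3P; split.
  - rewrite subUset sub1set (subsetP PV) //=; apply: subset_trans A0V.
    by clear -SA; by_elts.
  - by rewrite cardsU1 vS cS; clear -k_gt1; lia.
  apply: cliqueU1; first by clear -SA; by_elts.
  by apply: sub_clique kA0; clear -SA; by_elts.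
have [|S1 [S1A cS1 q1]] := mk v1 P v1P (subxx _) _ d1; first by rewrite cP; clear; lia.
have [|S2 [S2A cS2 q2]] := mk v2 (P :|: S1) v2P (subsetUl _ _) _ d2.
  by rewrite (leq_trans (leq_card_setU _ _).1) // cP cS1; clear; lia.
have [a aS2] : exists a, a \in S2 by apply/card_gt0P; rewrite cS2; clear -k_gt1; lia.
have /setDP[aA0 aPS] := subsetP S2A _ aS2.
have [||P2 [hP2 aP2 dP2]] := @ext_blue a P aA0; first by rewrite cP.
  by apply: contra aPS; rewrite inE => ->.
case: noG; apply: (gadget_of_path q1 q2 hP hP2 (x1 := v1) (x2 := v2) (x3 := a)).
- rewrite disjoint_subset; apply/subsetP=> x; rewrite !inE negb_or => /orP[/eqP->|xS1].
    rewrite v12; apply/negP=> /(subsetP S2A); rewrite !inE v1P //.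
  apply/andP; split.
    by apply/negP=> /eqP xv; have := subsetP S1A _ xS1; rewrite xv inE v2P.
  by apply/negP=> /(subsetP S2A); rewrite !inE xS1 orbT.
- by rewrite disjoint_sym.
- by rewrite inE v1P setU11.
- by rewrite inE v2P setU11.
- by rewrite inE aP2 !inE aS2 orbT.
Qed.

(** Otherwise there is a gadget path: [Q], a blue clique through [v] and [a1] completed in [B], a
    red clique in [A0] through [a1], and a blue clique through another vertex of the latter. *)
Let no_red_clique_at Q v a1 : kclique b k V Q -> [disjoint Q & A0] -> v \in Q ->
  a1 \in A0 -> edge (~~ b) v a1 -> #|B| <= 2 * k * #|B :&: nbh (~~ b) v| -> False.
Proof.
move=> hQ dQ vQ a1A e dv; have [_ A0V kA0 /(_ _ a1A) da1] := A0good.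
have /and3P[QV /eqP cQ kQ] := hQ.
have [|Q2 [Q2A cQ2 kQ2 a1Q2]] := clique_through (k := k) kA0 a1A.
  by have := A0_large; clear -k_gt1; lia.
have q2 : kclique b k V Q2 by apply/and3P; rewrite cQ2 (subset_trans Q2A).
have [a aQ2a] : exists a, a \in Q2 :\ a1.
  by apply/card_gt0P; have := cardsD1 a1 Q2; rewrite a1Q2 cQ2; clear -k_gt1; lia.
have [aa1 aQ2] := setD1P aQ2a.
have [|||S [SN cS kS]] := @B_blue k.-2 (((B :&: nbh (~~ b) v) :&: nbh (~~ b) a1) :\: Q2).
- by rewrite -setIA (subset_trans (subsetDl _ _)) // subsetIl.
- have := cardsDS_leq ((B :&: nbh (~~ b) v) :&: nbh (~~ b) a1) Q2; rewrite cQ2.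
  have := card_nbh_split c b a1 (B :&: nbh (~~ b) v).
  have : (a1 \in B :&: nbh (~~ b) v) <= 1 by case: (_ \in _).
  have : #|B :&: nbh (~~ b) v :&: nbh b a1| <= #|B :&: nbh b a1|.
    by apply: subset_leq_card; apply: setSI; apply: subsetIl.
  have : #|B :&: nbh b a1| + 4 * K <= #|B :&: nbh (~~ b) v|.
    rewrite -(@leq_pmul2l (4 * k)); last by rewrite muln_gt0 (ltnW k_gt1).
    move: B_large dv da1; clear; move: (#|_|) (#|_|) (#|_|) K => x y z w; nia.
  by clear -K_gt k_gt1; lia.
- by clear; lia.
have Sv : S \subset nbh (~~ b) v by clear -SN; by_elts.
have Sa : S \subset nbh (~~ b) a1 by clear -SN; by_elts.
have SQ : [disjoint S & Q2] by clear -SN; by_elts.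
have SB : S \subset B by clear -SN; by_elts.
have a1S : a1 \notin S by apply/negP=> /(subsetP Sa); rewrite nbhE edgexx.
have va1 := edge_neq e.
have vS : v \notin S by apply/negP=> /(subsetP Sv); rewrite nbhE edgexx.
have p1 : kclique (~~ b) k V (v |: (a1 |: S)).
  apply/and3P; split.
  - rewrite !subUset !sub1set (subsetP QV) // (subsetP A0V) //=.
    exact: subset_trans B_sub.
  - by rewrite !cardsU1 !inE negb_or va1 vS a1S cS; clear -k_gt1; lia.
  apply: cliqueU1; last exact: cliqueU1.
  by rewrite subUset sub1set nbhE e.
have aA : a \in A0 := subsetP Q2A _ aQ2.
have aP1 : a \notin v |: (a1 |: S).
  rewrite !inE !negb_or aa1 (disjointFl SQ aQ2) !andbT.
  by apply: contraTneq aA => ->; rewrite (disjointFr dQ).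
have [|P2 [hP2 aP2 dP2]] := ext_blue aA _ aP1.
  by case/and3P: p1 => _ /eqP->.
case: noG; apply: (gadget_of_path hQ q2 p1 hP2 (x1 := v) (x2 := a1) (x3 := a)).
- exact: disjointWr dQ.
- by rewrite disjoint_sym.
- by rewrite !inE eqxx.
- by rewrite !inE eqxx orbT.
- by rewrite inE aP2.
Qed.

Let A0B : [disjoint A0 & B].
Proof.
have [A1A _ kA0 _] := A0good; case: coreAB => _ _ _ cA1 [_ _ _ hAB].
rewrite disjoint_subset; apply/subsetP=> x xA; rewrite inE; apply/negP=> xB.
have [a aA1] : exists a, a \in A1 by apply/card_gt0P; rewrite cA1; clear -k_gt1; lia.
have e := hAB a x aA1 xB; have := cliqueP _ _ _ kA0 _ _ (subsetP A1A _ aA1) xA (edge_neq e).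
by rewrite edgeF.
Qed.

Let no_red_clique_B Q y : kclique b k V Q -> [disjoint Q & A0] -> y \in Q -> y \in B -> False.
Proof.
move=> hQ dQ yQ yB; have [A1A _ _ _] := A0good.
case: coreAB => _ _ _ cA1 [_ _ dB hAB].
have [a aA1] : exists a, a \in A1 by apply/card_gt0P; rewrite cA1; clear -k_gt1; lia.
apply: (no_red_clique_at hQ dQ yQ (subsetP A1A _ aA1)); first by rewrite edgeC hAB.
apply: leq_trans (_ : 4 * #|B :&: nbh (~~ b) y| <= _); last first.
  by rewrite leq_mul2r; clear -k_gt1; lia.
have := card_nbh_split c b y B; have := dB y yB; rewrite yB.
by have := B_large32; clear -K_gt k_gt1; lia.
Qed.

Let X := [set v in V :\: A0 | [exists a in A0, edge (~~ b) v a]].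
Let Z := (V :\: A0) :\: X.

(** Let [Q] be a red k-clique in [X]. If one of its vertices is blue to 1/(2k) of [B],
    [no_red_clique_at] applies. Otherwise at least about half of [B] is red to all of [Q], and
    exchanging a vertex of [Q] for one of these gives a red clique excluded by [no_red_clique_B]. *)
Let X_free : ~~ has_clique b k X.
Proof.
apply/negP=> /has_cliqueP[Q [QX cQ kQ]].
have dQ : [disjoint Q & A0].
  by rewrite disjoint_subset; apply/subsetP=> v /(subsetP QX); rewrite !inE => /andP[/andP[]].
have QV : Q \subset V by apply/subsetP=> v /(subsetP QX); rewrite !inE => /andP[/andP[]].
have hQ : kclique b k V Q by apply/and3P; rewrite cQ.
case: (boolP [exists v in Q, #|B| <= 2 * k * #|B :&: nbh (~~ b) v|]) => [/exists_inP[v vQ dv]|].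
  have := subsetP QX _ vQ; rewrite inE => /andP[_ /exists_inP[a aA e]].
  exact: (no_red_clique_at hQ dQ vQ aA e dv).
rewrite negb_exists_in => /forall_inP hv.
have := @card_common_nbhN _ c (~~ b) Q B (#|B| %/ (2 * k)).
set H := [set x in B | _] => cH.
have [y yH] : exists y, y \in H :\: Q.
  apply/card_gt0P; have := cardsDS_leq H Q.
  have : #|B| <= #|H| + #|Q| * (#|B| %/ (2 * k)).
    apply: cH => v /hv; rewrite -ltnNge => /ltnW h.
    by rewrite leq_divRL ?muln_gt0 ?(ltnW k_gt1) // mulnC.
  have := leq_trunc_div #|B| (2 * k); have := B_large32; rewrite cQ.
  clear -K_gt k_gt1; move: (_ %/ _) => d; nia.
have /setDP[] := yH; rewrite inE => /andP[yB /forall_inP hy] yQ.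
have [v0 v0Q] : exists v, v \in Q by apply/card_gt0P; rewrite cQ; clear -k_gt1; lia.
have Qy : Q \subset nbh b y.
  apply/subsetP=> v vQ; rewrite nbhE edgeC -[b]negbK edgeN ?hy //.
  by apply: contraNneq yQ => <-.
have yQ0 : y \notin Q :\ v0 by rewrite inE negb_and yQ orbT.
apply: (@no_red_clique_B (y |: (Q :\ v0)) y _ _ (setU11 _ _) yB).
  apply/and3P; split.
  - rewrite subUset sub1set (subsetP B_sub) // (subset_trans (subsetDl _ _)) //.
  - by rewrite cardsU1 yQ0; have := cardsD1 v0 Q; rewrite v0Q cQ => ->.
  apply: cliqueU1; first exact: subset_trans (subsetDl _ _) Qy.
  by apply: sub_clique kQ; apply: subsetDl.
rewrite disjoint_subset; apply/subsetP=> x; rewrite !inE => /orP[/eqP->|/andP[_ xQ]].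
  by rewrite (disjointFl A0B).
by rewrite (disjointFr dQ).
Qed.

Let Z_nbh z : z \in Z -> A0 \subset nbh b z.
Proof.
rewrite !inE negb_and negb_exists_in => /andP[+ /andP[zA zV]].
rewrite zA zV /= => /forall_inP hz; apply/subsetP=> a aA; rewrite nbhE -[b]negbK edgeN ?hz //.
by apply: contraNneq zA => ->.
Qed.

(** Double count the red edges between [Z] and [B]. By maximality of [A0], each vertex of [Z] is red
    to more than 1/(4k) of [B]. A vertex of [B] has at most [K] red neighbours in [Z]: more would
    contain a red (k-1)-clique, against [no_red_clique_B], or a blue k-clique, against
    [no_blue_pair]. *)
Let Z_small : #|Z| <= 4 * k * K.
Proof.
have ZV : Z \subset V by apply/subsetP=> z; rewrite !inE => /andP[_ /andP[]].
have ZA : [disjoint Z & A0].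
  by rewrite disjoint_subset; apply/subsetP=> z; rewrite !inE => /andP[_ /andP[]].
have hZ z : z \in Z -> #|B| < 4 * k * #|B :&: nbh b z|.
  move=> zZ; rewrite ltnNge; apply/negP=> dz.
  have [A1A A0V kA0 dA0] := A0good.
  have zA : z \notin A0 by rewrite (disjointFr ZA).
  have gz : good (z |: A0).
    apply/and4P; split; first by apply: subset_trans A1A (subsetUr _ _).
    - by rewrite subUset sub1set (subsetP ZV).
    - by apply: cliqueU1 => //; apply: Z_nbh.
    - by apply/forall_inP=> a /setU1P[->//|]; apply: dA0.
  have := maxsetsup A0max gz (subsetUr _ _) => e.
  by rewrite -e setU11 in zA.
have hB y : y \in B -> #|Z :&: nbh b y| <= K.
  move=> yB; rewrite leqNgt; apply/negP=> /ltnW cy.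
  have Zy : Z :&: nbh b y \subset V by apply: subset_trans ZV; apply: subsetIl.
  have cy2 : 2 ^ (k.-1 + k) <= #|Z :&: nbh b y|.
    by apply: leq_trans cy; rewrite leq_exp2l //; clear; lia.
  have /orP[/has_cliqueP[S [SZ cS kS]]|/has_cliqueP[P [PZ cP kP]]] := erdos_szekeres c b cy2.
    have yS : y \notin S by apply/negP=> /(subsetP SZ); rewrite !inE edgexx andbF.
    apply: (@no_red_clique_B (y |: S) y _ _ (setU11 _ _) yB).
      apply/and3P; split.
      - by rewrite subUset sub1set (subsetP B_sub) // (subset_trans SZ).
      - by rewrite cardsU1 yS cS; clear -k_gt1; lia.
      by apply: cliqueU1 => //; apply: subset_trans SZ (subsetIr _ _).
    rewrite disjoint_subset; apply/subsetP=> x; rewrite !inE => /orP[/eqP->|xS].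
      by rewrite (disjointFl A0B).
    by rewrite (disjointFr ZA) //; have /setIP[] := subsetP SZ _ xS.
  have pP : kclique (~~ b) k V P by apply/and3P; rewrite cP (subset_trans PZ).
  have /card_gt1P[v1 [v2 [v1P v2P v12]]] : 1 < #|P| by rewrite cP.
  have big v : v \in P -> 3 * k <= #|A0 :&: nbh b v|.
    move=> vP; rewrite (setIidPl _) ?A0_large //; apply: Z_nbh.
    by have /setIP[] := subsetP PZ _ vP.
  exact: (no_blue_pair pP v1P v2P v12 (big _ v1P) (big _ v2P)).
have B0 : 0 < #|B| by have := B_large32; clear -K_gt k_gt1; lia.
rewrite -(@leq_pmul2r #|B|) //.
apply: leq_trans (_ : \sum_(z in Z) 4 * k * #|B :&: nbh b z| <= _).
  by rewrite -sum_nat_const; apply: leq_sum => z /hZ/ltnW.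
rewrite -big_distrr /= double_count -[X in _ <= X]mulnA leq_mul2l; apply/orP; right.
by rewrite mulnC -sum_nat_const; apply: leq_sum => y /hB.
Qed.

(** Red cliques come from [A0] and from the set [E] of vertices with many red neighbours in [A0]. If
    they number fewer than n, then [A0] and [E] together have fewer than kn vertices, and the
    remaining set [D] is large enough for [packs_asym] with p = q = k - 1. *)
Lemma packs_no_gadget n rho :
  (forall W, W \subset V -> rho <= #|W| ->
     has_clique (~~ b) k.-1 W || has_clique b k.-1 W) ->
  asym_size k.-1 k < n -> 10 * k * (2 ^ (k + 2) + k * (5 * k * K)) <= n ->
  (2 * k - 1) * n + rho <= #|V| + 2 ->
  packs b k n V \/ packs (~~ b) k n V.
Proof.
move=> hrho n_asym n_K cV; set K2 := 2 ^ (k + 2) + k * (5 * k * K) in n_K.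
have [_ A0V kA0 _] := A0good.
have k0 : 0 < k := ltnW k_gt1.
have K2k : 5 * k * K <= K2.
  by rewrite /K2; apply: leq_trans (leq_addl _ _); rewrite leq_pmull.
have k1e : k.-1.+1 = k by rewrite prednK.
have e2k : (2 * k - 1) * n = k * n + k.-1 * n by rewrite -mulnDl; congr (_ * _); clear -k0; lia.
have kn : n <= k.-1 * n by rewrite leq_pmull //; clear -k_gt1; lia.
have XV : X \subset V by apply/subsetP=> v; rewrite !inE => /andP[/andP[]].
have XA0 : [disjoint X & A0].
  by rewrite disjoint_subset; apply/subsetP=> v; rewrite !inE => /andP[/andP[]].
have K_e : 2 ^ (k + k) = K by rewrite addnn -mul2n.
have [Xbig|Xsmall] := leqP (k * n + K) #|X|.
  right; apply: packs_sub XV _; apply: (@packs_large _ _ _ _ k); last by rewrite K_e.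
  by rewrite negbK.
have cA0X : #|V| = #|A0| + #|X| + #|Z|.
  have sX : X \subset V :\: A0 by apply/subsetP=> v; rewrite inE => /andP[].
  have := subset_leq_card A0V; have := subset_leq_card sX.
  by rewrite /Z !cardsDS //; clear; lia.
have A0big : k.-1 * n <= #|A0| + 5 * k * K + 2.
  by move: Z_small; clear -cA0X cV Xsmall e2k k0; nia.
have A0K2 : K2 + 2 <= #|A0|.
  have : K2 * 10 <= n.
    by apply: leq_trans n_K; rewrite mulnC leq_mul2r leq_pmulr ?orbT.
  by clear -A0big K2k kn K_gt k_gt1; lia.
(* [K2] is the degree that [absorb_into] requires with q = 2, as [A0] has no blue edge, for a set of
   at most 5kK vertices. *)
pose E := [set v in V :\: A0 | K2 <= #|A0 :&: nbh b v|].
have EV : E \subset V by apply/subsetP=> v; rewrite !inE => /andP[/andP[]].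
have EA0 : [disjoint E & A0].
  by rewrite disjoint_subset; apply/subsetP=> v; rewrite !inE => /andP[/andP[]].
have K2_3k : 3 * k <= K2.
  by apply: leq_trans K2k; apply: leq_mul; clear -K_gt k_gt1; lia.
have cE : #|E| <= 5 * k * K.
  have cEX : #|E :&: X| < K.
    rewrite -K_e; apply: (@no_clique_bound _ c b).
      by apply: contra X_free; apply: has_clique_sub; apply: subsetIr.
    apply/negP=> /has_cliqueP[P [PE cP kP]].
    have PE' v : v \in P -> 3 * k <= #|A0 :&: nbh b v|.
      move=> /(subsetP PE)/setIP[+ _]; rewrite inE => /andP[_]; exact: leq_trans K2_3k.
    have hP : kclique (~~ b) k V P.
      by apply/and3P; rewrite cP (subset_trans PE (subset_trans (subsetIl _ _) EV)).
    have /card_gt1P[v1 [v2 [v1P v2P v12]]] : 1 < #|P| by rewrite cP.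
    exact: (no_blue_pair hP v1P v2P v12 (PE' _ v1P) (PE' _ v2P)).
  have cEZ : #|E :\: X| <= #|Z|.
    by apply: subset_leq_card; apply: setSD; apply/subsetP=> v; rewrite inE => /andP[].
  by have := cardsID X E; move: Z_small; clear -cEX cEZ k_gt1; nia.
have nA0 : ~~ has_clique (~~ b) 2 A0.
  apply/negP=> /has_cliqueP[S [SA cS kS]].
  have /card_gt1P[x [y [xS yS xy]]] : 1 < #|S| by rewrite cS.
  have := cliqueP _ _ _ kS _ _ xS yS xy.
  by rewrite edgeN // (cliqueP _ _ _ kA0) ?(subsetP SA).
have [|H1 H1A tH1] := absorb_into k0 nA0 EA0.
  move=> u; rewrite inE => /andP[_]; apply: leq_trans.
  by rewrite /K2 leq_add2l leq_mul2l cE orbT.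
have [|R RA cR] := @subset_of_card _ (A0 :\: H1) (k * (#|A0 :\: H1| %/ k)).
  by rewrite mulnC leq_trunc_div.
have pR : packs b k (#|E| + #|A0 :\: H1| %/ k) V.
  apply: (@packs_sub _ _ _ _ _ ((E :|: H1) :|: R)).
    have RA0 : R \subset A0 := subset_trans RA (subsetDl _ _).
    by rewrite !subUset EV !(subset_trans _ A0V).
  apply: packsU; first by clear -RA EA0; by_elts.
    by exists (E :|: H1).
  exists R => //; apply: clique_tiles cR; apply: sub_clique kA0.
  exact: subset_trans RA (subsetDl _ _).
have [le|gt] := leqP n (#|E| + #|A0 :\: H1| %/ k); first by left; apply: packs_leq pR.
right.
(* Each vertex of [E] is the only one of [E] in its clique, so [E] and [H1] have exactly k times
   [#|E|] vertices; the rest of [A0] wastes fewer than k. *)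
have cA0E : #|A0| + #|E| < k * n.
  have := tiles_card tH1; rewrite cardsU (disjoint_setI0 (disjointWr H1A EA0)) cards0 subn0.
  have := cardsDS H1A; have := subset_leq_card H1A; have := ltn_ceil #|A0 :\: H1| k0.
  have : k * (#|E| + #|A0 :\: H1| %/ k).+1 <= k * n by rewrite leq_mul2l gt orbT.
  rewrite mulnS mulnDr [_.+1 * k]mulnC mulnS; clear.
  by move: (_ %/ _) => d; set x := k * d; set y := k * #|E|; set z := k * n; lia.
pose D := (V :\: A0) :\: E.
have cD : #|V| = #|A0| + #|E| + #|D|.
  have sE : E \subset V :\: A0 by apply/subsetP=> v; rewrite inE => /andP[].
  have := subset_leq_card A0V; have := subset_leq_card sE.
  by rewrite /D !cardsDS //; clear; lia.
have D_red v : v \in D -> #|A0 :&: nbh b v| <= K2.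
  by move=> /setDP[vVA]; rewrite inE vVA /= -ltnNge => /ltnW.
have DX : D \subset X.
  apply/subsetP=> v vD; have := D_red v vD; have /setDP[vVA vE] := vD.
  rewrite inE vVA /= => dv; apply: contraT; rewrite negb_exists_in => /forall_inP hv.
  have vA0 : v \notin A0 by have /setDP[] := vVA.
  have : A0 \subset nbh b v.
    apply/subsetP=> a aA; rewrite nbhE -[b]negbK edgeN ?hv //.
    by apply: contraNneq vA0 => ->.
  by move=> /setIidPl eA; rewrite eA in dv; move: dv A0K2; clear; lia.
have D_free : ~~ has_clique (~~ ~~ b) k D.
  by rewrite negbK; apply: contra X_free; apply: has_clique_sub.
have DV : D \subset V := subset_trans DX XV.
have DA0 : [disjoint D & A0] := disjointWl DX XA0.
have DAV : D :|: A0 \subset V by rewrite subUset DV.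
have hext n' D' : D' \subset D -> n' + k.-1 * K2 <= #|A0| ->
    packs (~~ b) k.-1 n' D' -> packs (~~ b) k n' (D' :|: A0).
  move=> D'D cn pD; rewrite -[k in packs _ k]k1e.
  apply: packs_extend cn pD; first exact: disjointWl DA0.
  by move=> v /(subsetP D'D); rewrite negbK; apply: D_red.
(* When A0 has too few vertices to extend n cliques (as for k = 2), D is large
   enough to contain the missing K_k. *)
have [A0n|A0n] := leqP (n + k.-1 * K2) #|A0|.
  apply: packs_sub DAV _; apply: hext A0n _ => //.
  apply: (@packs_asym _ _ _ _ k.-1 rho); rewrite ?k1e //.
  - by clear -k_gt1; lia.
  - move=> W WD cW; rewrite negbK; apply: hrho => //; exact: subset_trans DV.
  - by move: n_asym kn cD cV cA0E e2k; clear; set z := asym_size _ _; lia.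
  - by move: cD cV cA0E e2k; clear; lia.
have K2n : 10 * (k * K2) <= n by rewrite mulnA.
have K2k' : K2 <= k * K2 by rewrite leq_pmull.
have k1K2 : k.-1 * K2 <= k * K2 by rewrite leq_mul2r leq_pred orbT.
have K5 : K <= 5 * k * K by rewrite leq_pmull // muln_gt0.
have e5 : 5 * k * K = 5 * (k * K) by rewrite mulnA.
pose n' := #|A0| - k.-1 * K2.
have n'A0 : n' + k.-1 * K2 = #|A0|.
  rewrite /n' subnK //; move: A0big kn K2n k1K2 K2k' K2k; clear; lia.
have n'n : n' < n by rewrite -n'A0 ltn_add2r in A0n.
have ekn : k * (n - n') + k.-1 * n' + n' = k * n.
  rewrite -addnA -mulSnr k1e -mulnDr subnK //; exact: ltnW.
(* [A0] extends [n'] cliques, the other n - n' being found whole in [D]. The surplus of order (k -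
   1)n in [V] pays for [E], for (k - 1)[K2] and for the spare [K]. *)
have cDn : k * (n - n') + k.-1 * n' + K <= #|D|.
  move: ekn n'A0 cD cV e2k cE K2n K2k' k1K2 K2k K5 kn K_gt k_gt1; clear.
  by set x := k * (n - n'); set y := k.-1 * n'; set z := k * n; lia.
have [|D2 D2D tD2] := @packs_large _ c (~~ b) k k (n - n') D D_free.
  by rewrite K_e; move: cDn; clear; set x := k * _; set y := k.-1 * _; lia.
have pD3 : packs (~~ b) k.-1 n' (D :\: D2).
  apply: (@packs_large _ _ _ _ k).
    by apply: contra D_free; apply: has_clique_sub; apply: subsetDl.
  rewrite cardsDS // (tiles_card tD2).
  have : 2 ^ (k.-1 + k) <= K by rewrite leq_exp2l //; clear; lia.
  by move: cDn; clear; set x := k * _; set y := k.-1 * _; lia.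
apply: packs_sub (_ : D2 :|: ((D :\: D2) :|: A0) \subset V) _.
  by rewrite !subUset A0V (subset_trans D2D) // (subset_trans (subsetDl _ _)).
rewrite -(subnK (ltnW n'n)); apply: packsU.
- by clear -D2D DA0; by_elts.
- by exists D2.
- by apply: hext pD3; rewrite ?subsetDl // n'A0.
Qed.

End NoGadget.

(** * Removal of gadgets and the upper bound *)

Section Excess.
Variables (T : finType) (c : {set T} -> bool) (k rho : nat).
Implicit Types (V W A B : {set T}).
Hypothesis k_gt1 : 1 < k.
Hypothesis rhoP : forall W, rho <= #|W| ->
  has_clique c true k.-1 W || has_clique c false k.-1 W.

(** The additive term of [packs_weak] for s = 2^(3k + 4), plus 2 for the - 2 in the formula.
    [copies_size] adds the thresholds on n from [packs_no_gadget]. *)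
Definition core_size := 2 ^ (3 * k + 4) * 2 ^ (28 * k + 5) + 2 ^ (2 * k) + 2.
Definition copies_size :=
  (asym_size k.-1 k).+1 + 10 * k * (2 ^ (k + 2) + k * (5 * k * 2 ^ (2 * k))) + core_size.

(* The excess of the number of vertices over (2k-1)n + rho - 2 is core_size - d,
   so that at most [d] gadgets can be removed before [packs_weak] applies. *)
Lemma packs_excess d n V : copies_size + 2 * d <= n ->
  (2 * k - 1) * n + rho + core_size <= #|V| + 2 + d -> d <= core_size ->
  packs c true k n V \/ packs c false k n V.
Proof.
have k0 := ltnW k_gt1.
elim: d n V => [|d IHd] n V n_big cV dE.
  apply: (@packs_weak _ c k (2 ^ (3 * k + 4))) => //.
    by rewrite leq_exp2l //; clear; lia.
  by move: cV; rewrite /core_size; clear; set x := 2 ^ _ * _; lia.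
case: n n_big cV => [|n] n_big cV; first by move: n_big; rewrite /copies_size; clear; lia.
have [gad|nog] := boolp.EM (gadget c k V).
  case: n n_big cV => [|n] n_big cV.
    by move: n_big; rewrite /copies_size /core_size; clear; lia.
  apply: packs_gadget gad _ => U UV cU; apply: IHd; last exact: ltnW.
    by move: n_big; clear; lia.
  (* The formula drops by 4k - 2 and the vertices by at most 4k - 3, so the excess gains 1 and [d]
     decreases. *)
  have e : (2 * k - 1) * n.+2 = (2 * k - 1) * n + (4 * k - 2) by clear -k_gt1; nia.
  by move: cU cV; rewrite e; clear -k_gt1; lia.
have e2k : (2 * k - 1) * n.+1 = k * n.+1 + k.-1 * n.+1.
  by rewrite -mulnDl; congr (_ * _); clear -k0; lia.
have kn : n.+1 <= k.-1 * n.+1 by rewrite leq_pmull //; clear -k_gt1; lia.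
have [|h|h|[b [A1 [B coreAB]]]] := @packs_or_core _ c k (2 ^ (3 * k + 4)) n V k0 (expn_gt0 _ _).
- have : core_size <= n.+1 by move: n_big; rewrite /copies_size; clear; lia.
  move: cV dE; rewrite e2k /core_size mulnS; move: kn; clear.
  by set x := 2 ^ _ * _; lia.
- by left.
- by right.
have [A1V BV kA1 cA1 [nB cB dB hAB]] := coreAB.
pose good A := [&& A1 \subset A, A \subset V, clique c b A &
  [forall a in A, 4 * k * #|B :&: nbh c b a| <= #|B|]].
have good1 : good A1.
  rewrite /good subxx A1V kA1 /=; apply/forall_inP=> a aA.
  rewrite (_ : B :&: _ = set0) ?cards0 ?muln0 //; apply/setP=> x; rewrite !inE.
  apply/negbTE/negP=> /andP[xB e]; have := hAB a x aA xB; rewrite -[b]negbK in e.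
  by rewrite (edgeF e).
have [A0 A0max A1A0] := maxset_exists good1.
have hr W : W \subset V -> rho <= #|W| -> has_clique c (~~ b) k.-1 W || has_clique c b k.-1 W.
  by move=> _ /rhoP; case: b {coreAB kA1 nB dB hAB good good1 A0max} => //=; rewrite orbC.
have := packs_no_gadget k_gt1 nog coreAB A0max hr.
move=> /(_ n.+1); case: b {coreAB kA1 nB dB hAB good good1 A0max hr} => /= h.
  apply: h; move: n_big cV dE; rewrite /copies_size; clear; set x := core_size; lia.
by apply/or_comm; apply: h; move: n_big cV dE; rewrite /copies_size; clear; set x := core_size; lia.
Qed.

Lemma packs_upper n : copies_size + 2 * core_size <= n ->
  (2 * k - 1) * n + rho <= #|T| + 2 ->
  packs c true k n [set: T] \/ packs c false k n [set: T].
Proof.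
move=> n_big cT; apply: packs_excess n_big _ (leqnn _).
by rewrite cardsT; move: cT; clear; lia.
Qed.

End Excess.

(** * Ramsey numbers of graphs *)

Section Embeddings.
Variables (T : finType) (c : {set T} -> bool).
Implicit Types (b : bool) (A S U W : {set T}).

Lemma has_clique_of_inj b m W (g : 'I_m -> T) : injective g ->
  (forall i, g i \in W) -> (forall i j, i != j -> c [set g i; g j] = b) ->
  has_clique c b m W.
Proof.
move=> g_inj gW gE; apply/has_cliqueP; exists (g @: [set: 'I_m]); split.
- by apply/subsetP=> _ /imsetP[i _ ->].
- by rewrite card_imset // cardsT card_ord.
apply/cliqueP=> _ _ /imsetP[i _ ->] /imsetP[j _ ->] ij; rewrite /edge ij gE ?eqxx //.
by apply: contraNneq ij => ->.
Qed.

Lemma clique_inj b m S : #|S| = m -> clique c b S ->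
  exists g : 'I_m -> T, [/\ injective g, forall i, g i \in S &
    forall i j, i != j -> c [set g i; g j] = b].
Proof.
move=> cS kS; exists (fun i => enum_val (cast_ord (esym cS) i)); split.
- by move=> i j /enum_val_inj/cast_ord_inj.
- by move=> i; apply: enum_valP.
move=> i j ij.
have : edge c b (enum_val (cast_ord (esym cS) i)) (enum_val (cast_ord (esym cS) j)).
  apply: (cliqueP _ _ _ kS); rewrite ?enum_valP //.
  by apply: contraNneq ij => /enum_val_inj/cast_ord_inj ->.
by case/andP=> _ /eqP.
Qed.

Lemma packs_of_inj b n k (f : 'I_n * 'I_k -> T) : injective f ->
  (forall u v, u.1 = v.1 -> u.2 != v.2 -> c [set f u; f v] = b) ->
  packs c b k n [set: T].
Proof.
move=> f_inj fE.
have H m : m <= n -> packs c b k m (f @: [set u : 'I_n * 'I_k | u.1 < m]).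
  elim: m => [|m IHm] mn; first by exists set0; rewrite ?sub0set.
  pose i := Ordinal mn; pose S := f @: [set u : 'I_n * 'I_k | u.1 == i].
  apply: (@packsS _ _ _ _ _ S).
  - by apply: imsetS; apply/subsetP=> u; rewrite !inE => /eqP->; rewrite /= ltnS.
  - rewrite card_imset //; have -> : [set u : 'I_n * 'I_k | u.1 == i] = setX [set i] [set: 'I_k].
      by apply/setP=> -[x y]; rewrite !inE /= andbT.
    by rewrite cardsX cards1 cardsT card_ord mul1n.
  - apply/cliqueP=> _ _ /imsetP[u + ->] /imsetP[v + ->].
    rewrite !inE => /eqP ui /eqP vi uv; rewrite /edge uv fE ?eqxx ?ui ?vi //.
    apply: contraNneq uv; case: u v ui vi => [u1 u2] [v1 v2] /= -> -> ->; exact: eqxx.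
  apply: packs_sub (IHm (ltnW mn)).
  apply/subsetP=> _ /imsetP[u + ->]; rewrite !inE => um; apply/andP; split.
    apply/negP=> /imsetP[v + /f_inj e]; rewrite -e inE => /eqP ui.
    by rewrite ui ltnn in um.
  by apply: imset_f; rewrite inE ltnW.
by apply: packs_sub (H n (leqnn n)); apply: subsetT.
Qed.

(** Copies are indexed by [nat], so that the induction can shift them; [x0] is a default value for
    indices from n on. *)
Lemma packs_inj (x0 : T) b n k U : packs c b k n U ->
  exists f : nat -> 'I_k -> T,
    [/\ forall i j, i < n -> f i j \in U,
        forall i i' j j', i < n -> i' < n -> f i j = f i' j' -> i = i' /\ j = j' &
        forall i j j', i < n -> j != j' -> c [set f i j; f i j'] = b].
Proof.
case=> V VU; elim: n U V VU => [|n IHn] U V VU /=; first by exists (fun _ _ => x0).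
case=> S [SV cS kS tV].
have [f [fV f_inj fE]] := IHn (V :\: S) _ (subxx _) tV.
have [g [g_inj gS gE]] := clique_inj cS kS.
exists (fun i => if i is i'.+1 then f i' else g); split.
- move=> [|i] j; rewrite ?ltnS => iN.
    by apply: (subsetP VU); apply: (subsetP SV).
  by apply: (subsetP VU); have /setDP[] := fV i j iN.
- move=> [|i] [|i'] j j'; rewrite ?ltnS => iN i'N.
  + by move=> /g_inj->.
  + by move=> e; have /setDP[_] := fV i' j' i'N; rewrite -e gS.
  + by move=> e; have /setDP[_] := fV i j iN; rewrite e gS.
  + by move=> /(f_inj _ _ _ _ iN i'N)[-> ->].
- by move=> [|i] j j'; rewrite ?ltnS => iN jj'; [apply: gE | apply: fE].
Qed.

Lemma tiles_weight b p w t A U :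
  (forall S, #|S| = p -> clique c b S -> w <= #|S :&: A|) ->
  tiles c b p t U -> w * t <= #|U :&: A|.
Proof.
move=> hw; elim: t U => [|t IHt] U /=; first by rewrite muln0.
case=> S [SU cS kS /IHt h].
have := hw S cS kS; have := cardsID S (U :&: A).
have -> : (U :&: A) :&: S = S :&: A by by_elts.
have -> : (U :&: A) :\: S = (U :\: S) :&: A by by_elts.
by rewrite mulnS; lia.
Qed.

End Embeddings.

Lemma arrows_complete N m : arrows N 'K_m =
  [forall c : {ffun {set 'I_N} -> bool},
    has_clique c true m [set: 'I_N] || has_clique c false m [set: 'I_N]].
Proof.
apply: eq_forallb => c.
have E b : [exists f : {ffun 'K_m -> 'I_N}, mono_copy c b f] = has_clique c b m [set: 'I_N].
  apply/existsP/idP=> [[f /andP[/injectiveP f_inj /forallP fE]]|].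
    apply: (@has_clique_of_inj _ _ _ _ _ (fun i : 'I_m => f i)) => // i j ij.
    by have /forallP/(_ j)/implyP/(_ ij)/eqP := fE i.
  case/has_cliqueP=> S [_ cS kS]; have [g [g_inj _ gE]] := clique_inj cS kS.
  exists (@finfun 'K_m (fun=> 'I_N) g); apply/andP; split.
    by apply/injectiveP=> i j; rewrite !ffunE; apply: g_inj.
  by apply/forallP=> i; apply/forallP=> j; apply/implyP=> ij; rewrite !ffunE gE.
rewrite -!E; apply/existsP/orP=> [[[] h]|[h|h]]; by [left|right|exists true|exists false].
Qed.

Lemma arrows_copies N n k : 0 < N ->
  (forall c : {ffun {set 'I_N} -> bool},
    packs c true k n [set: 'I_N] \/ packs c false k n [set: 'I_N]) ->
  arrows N (copies n 'K_k).
Proof.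
move=> N0 h; apply/forallP=> c.
suff H b : packs c b k n [set: 'I_N] ->
    exists b, exists f : {ffun copies n 'K_k -> 'I_N}, mono_copy c b f.
  have [b [f hf]] : exists b, exists f : {ffun copies n 'K_k -> 'I_N}, mono_copy c b f.
    by have [/H|/H] := h c.
  by apply/existsP; exists b; apply/existsP; exists f.
case/(packs_inj (Ordinal N0)) => f [_ f_inj fE].
exists b, (@finfun (copies n 'K_k) (fun=> 'I_N) (fun u => f u.1 u.2)); apply/andP; split.
  apply/injectiveP=> -[i j] [i' j']; rewrite !ffunE /= => /f_inj[] // /val_inj-> ->.
  by [].
apply/forallP=> -[i j]; apply/forallP=> -[i' j']; apply/implyP=> /andP[/= /eqP-> jj'].
by rewrite !ffunE fE.
Qed.

Lemma packs_of_arrows N n k (c : {ffun {set 'I_N} -> bool}) : arrows N (copies n 'K_k) ->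
  exists b, packs c b k n [set: 'I_N].
Proof.
move=> /forallP/(_ c)/existsP[b /existsP[f /andP[/injectiveP f_inj /forallP fE]]].
exists b; apply: (@packs_of_inj _ _ _ _ _ (fun u => f u)) => // u v uv1 uv2.
have /forallP/(_ v)/implyP h := fE u.
by apply/eqP; apply: h; rewrite /= /copies_adj uv1 eqxx.
Qed.

Lemma ramsey_arrows G : arrows (ramsey G) G.
Proof. by rewrite /ramsey; case: ex_minnP. Qed.

Lemma ramsey_min G N : arrows N G -> ramsey G <= N.
Proof. by rewrite /ramsey; case: ex_minnP => m _; apply. Qed.

Lemma ramsey_has_clique m (T : finType) (c : {set T} -> bool) (W : {set T}) :
  ramsey 'K_m <= #|W| -> has_clique c true m W || has_clique c false m W.
Proof.
move=> cW; have := ramsey_arrows 'K_m; set r := ramsey _ in cW *.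
rewrite arrows_complete.
pose h (i : 'I_r) : T := enum_val (widen_ord cW i).
have h_inj : injective h.
  by move=> i j /enum_val_inj e; apply: val_inj; have := congr1 val e.
(* The colouring is pulled back along an injection of r points into [W]. *)
move=> /forallP/(_ [ffun X : {set 'I_r} => c (h @: X)]).
have H b : has_clique [ffun X : {set 'I_r} => c (h @: X)] b m [set: 'I_r] -> has_clique c b m W.
  case/has_cliqueP=> S [_ cS kS]; have [g [g_inj _ gE]] := clique_inj cS kS.
  apply: (@has_clique_of_inj _ _ _ _ _ (h \o g)).
  - exact: inj_comp.
  - by move=> i; apply: enum_valP.
  - by move=> i j /gE; rewrite ffunE imsetU !imset_set1.
by case/orP=> /H->; rewrite ?orbT.
Qed.

Lemma ramsey_complete_gt0 m : 0 < m -> 0 < ramsey 'K_m.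
Proof.
move=> m0; rewrite lt0n; apply/eqP=> r0; have := ramsey_arrows 'K_m.
rewrite r0 arrows_complete => /forallP/(_ [ffun=> true]).
have H (c : {set 'I_0} -> bool) b : ~~ has_clique c b m [set: 'I_0].
  apply/negP=> /has_cliqueP[S [_ cS _]]; have := max_card (mem S).
  by rewrite cS card_ord leqNgt m0.
by rewrite !(negbTE (H _ _)).
Qed.

Lemma card_ord_interval m lo hi : #|[set i : 'I_m | lo <= i < hi]| <= hi - lo.
Proof.
rewrite cardE -(size_map val) -(size_iota lo (hi - lo)); apply: uniq_leq_size.
  by rewrite map_inj_uniq ?enum_uniq //; apply: val_inj.
by move=> x /mapP[i]; rewrite mem_enum inE mem_iota => + ->; clear; rewrite /=; lia.
Qed.

Lemma ramsey_extremal m : 0 < m ->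
  exists c : {ffun {set 'I_(ramsey 'K_m).-1} -> bool},
    forall b, ~~ has_clique c b m [set: 'I_(ramsey 'K_m).-1].
Proof.
move=> m0; have : ~~ arrows (ramsey 'K_m).-1 'K_m.
  by apply/negP=> /ramsey_min; rewrite leqNgt prednK ?leqnn // ramsey_complete_gt0.
rewrite arrows_complete => /forallPn[c]; rewrite negb_or => /andP[h1 h2].
by exists c; case.
Qed.

(** * The extremal colouring *)

Section LowerBound.
Variables (k n m : nat).
Hypotheses (k_gt1 : 1 < k) (n_gt0 : 0 < n).
Let r := (ramsey 'K_(k - 1)).-1.
Hypothesis m_small : m < (2 * k - 1) * n + ramsey 'K_(k - 1) - 2.

Let r_gt0 : ramsey 'K_(k - 1) = r.+1.
Proof. by rewrite prednK // ramsey_complete_gt0 // subn_gt0. Qed.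

(** Consecutive intervals, possibly cut short by m: only upper bounds on the sizes of [A] and [B]
    are used. *)
Let C : {set 'I_m} := [set i : 'I_m | i < r].
Let A : {set 'I_m} := [set i : 'I_m | r <= i < r + (k * n - 1)].
Let B : {set 'I_m} := [set i : 'I_m | r + (k * n - 1) <= i < m].

Let card_A : #|A| < k * n.
Proof.
have kn0 : 0 < k * n by rewrite muln_gt0 n_gt0 ltnW.
by apply: leq_ltn_trans (card_ord_interval _ _ _) _; move: kn0; clear; lia.
Qed.

Let card_B : #|B| < (k - 1) * n.
Proof.
apply: leq_ltn_trans (card_ord_interval _ _ _) _.
have e : (2 * k - 1) * n = k * n + (k - 1) * n.
  by rewrite -mulnDl; congr (_ * _); move: k_gt1; clear; lia.
have kn0 : 0 < k * n by rewrite muln_gt0 n_gt0 ltnW.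
have k1n0 : 0 < (k - 1) * n by rewrite muln_gt0 n_gt0 subn_gt0 k_gt1.
by move: m_small kn0 k1n0; rewrite e r_gt0; clear; set x := (k - 1) * n; set y := k * n; lia.
Qed.

Let inB x : (x \in B) = (x \notin C) && (x \notin A).
Proof. by rewrite !inE; have := ltn_ord x; clear; lia. Qed.

Let A_C x : x \in A -> x \notin C.
Proof. by rewrite !inE; clear; lia. Qed.

Variable c0 : {ffun {set 'I_r} -> bool}.
Hypothesis c0_free : forall b, ~~ has_clique c0 b (k - 1) [set: 'I_r].

(** Red is [true]. On [C] the colouring [c0] is read through the values of the ordinals. *)
Let col : {ffun {set 'I_m} -> bool} := [ffun X : {set 'I_m} =>
  if X \subset C then c0 [set j : 'I_r | [exists i in X, val i == val j]]
  else if X \subset A then true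
  else ~~ ((X :&: A != set0) || (X \subset B))].

Let meetsA x y : ([set x; y] :&: A != set0) = (x \in A) || (y \in A).
Proof.
apply/set0Pn/orP=> [[z]|[zA|zA]]; last 2 first.
- by exists x; rewrite in_setI set21.
- by exists y; rewrite in_setI set22.
by case/setIP=> /set2P[]-> zA; [left|right].
Qed.

Let colE x y : col [set x; y] =
  if (x \in C) && (y \in C) then c0 [set j : 'I_r | [exists i in [set x; y], val i == val j]]
  else if (x \in A) && (y \in A) then true
  else ~~ [|| x \in A, y \in A | (x \in B) && (y \in B)].
Proof. by rewrite ffunE meetsA !subUset !sub1set orbA. Qed.

Let C_free b : ~~ has_clique col b (k - 1) C.
Proof.
apply/negP=> /has_cliqueP[S [SC cS kS]].
have [x xS] : exists x, x \in S.
  by apply/card_gt0P; rewrite cS subn_gt0.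
have xr : x < r by have := subsetP SC x xS; rewrite inE.
pose h (y : 'I_m) : 'I_r := insubd (Ordinal xr) (val y).
have hE y : y \in C -> val (h y) = val y.
  by rewrite inE /h val_insubd => ->.
case/negP: (c0_free b).
have [g [g_inj gS gE]] := clique_inj cS kS.
have gC i : g i \in C := subsetP SC _ (gS i).
apply: (@has_clique_of_inj _ _ _ _ _ (h \o g)) => //.
  move=> i j /= e; apply: g_inj; apply: val_inj.
  by rewrite -(hE _ (gC i)) -(hE _ (gC j)) e.
move=> i j /gE <-; rewrite colE !gC /=; congr (c0 _); apply/setP=> l; rewrite !inE.
apply/orP/exists_inP=> [[/eqP->|/eqP->]|[z /set2P[]-> /eqP e]].
- by exists (g i); rewrite ?set21 // hE.
- by exists (g j); rewrite ?set22 // hE.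
- by left; apply/eqP/val_inj; rewrite hE.
- by right; apply/eqP/val_inj; rewrite hE.
Qed.

Let few_C b S : clique col b S -> #|S :&: C| < k - 1.
Proof.
move=> kS; rewrite ltnNge; apply/negP=> h; case/negP: (C_free b).
apply: has_clique_leq h _; apply/has_cliqueP; exists (S :&: C).
by split; rewrite ?subsetIr //; apply: sub_clique kS; apply: subsetIl.
Qed.

Let at_most_one b S (D : {set 'I_m}) : clique col b S ->
  (forall x y, x \in D -> y \in D -> x != y -> col [set x; y] != b) -> #|S :&: D| <= 1.
Proof.
move=> kS hD; rewrite leqNgt; apply/negP=> /card_gt1P[x [y [/setIP[xS xD] /setIP[yS yD] xy]]].
have /andP[_] := cliqueP _ _ _ kS _ _ xS yS xy.
by apply/negP; apply: hD.
Qed.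

Let card_split (S : {set 'I_m}) : #|S| = #|S :&: A| + #|S :&: B| + #|S :&: C|.
Proof.
rewrite -(cardsID C S) addnC -(cardsID A (S :\: C)).
have -> : (S :\: C) :&: A = S :&: A.
  apply/setP=> x; rewrite in_setI in_setD in_setI.
  by case xA: (x \in A); rewrite ?andbF // A_C.
have -> // : (S :\: C) :\: A = S :&: B.
apply/setP=> x; rewrite !in_setD in_setI inB.
by case: (x \in S); case: (x \in A); case: (x \in C).
Qed.

(** A red k-clique has at most one vertex in [B] and at most k - 2 in [C], so it meets [A], which no
    red edge leaves: it uses k vertices of [A]. A blue one has at most one vertex in [A]; meeting
    [C] would exclude [B] and leave at most k - 1 vertices, so it uses at least k - 1 vertices of
    [B]. Neither set has room for n disjoint ones. *)
Lemma not_arrows_extremal : ~~ arrows m (copies n 'K_k).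
Proof.
apply/negP=> /(packs_of_arrows col)[b [U _ tU]].
have CA x : x \in C -> x \notin A by apply: contraTN => /A_C.
case: b tU => tU.
  suff /tiles_weight/(_ tU) h : forall S : {set 'I_m},
      #|S| = k -> clique col true S -> k <= #|S :&: A|.
    have := subset_leq_card (subsetIr U A); move: h card_A; clear; lia.
  move=> S cS kS; have := few_C kS; have := card_split S; rewrite cS.
  have : #|S :&: B| <= 1.
    apply: (at_most_one kS) => x y xB yB _; rewrite colE xB yB.
    move: xB yB; rewrite !inB => /andP[/negbTE-> /negbTE->] /andP[/negbTE-> /negbTE->].
    by [].
  move=> cB cK cC; have [x /setIP[xS xA]] : exists x, x \in S :&: A.
    by apply/card_gt0P; move: cB cK cC k_gt1; clear; lia.
  suff /setIidPl-> : S \subset A by rewrite cS.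
  apply/subsetP=> y yS; apply: contraT => yA.
  have xy : x != y by apply: contraTneq xA => ->.
  have /andP[_] := cliqueP _ _ _ kS _ _ xS yS xy.
  by rewrite colE xA (negbTE (A_C xA)) (negbTE yA).
suff /tiles_weight/(_ tU) h : forall S : {set 'I_m},
    #|S| = k -> clique col false S -> k - 1 <= #|S :&: B|.
  have := subset_leq_card (subsetIr U B); move: h card_B; clear; lia.
move=> S cS kS; have := few_C kS; have := card_split S; rewrite cS.
have : #|S :&: A| <= 1.
  by apply: (at_most_one kS) => x y xA yA _; rewrite colE xA yA (negbTE (A_C xA)).
have [-> |[x /setIP[xS xC]]] := set_0Vmem (S :&: C).
  by rewrite cards0; clear; lia.
rewrite (_ : S :&: B = set0) ?cards0; first by move: k_gt1; clear; lia.
apply/eqP; rewrite -subset0; apply/subsetP=> y /setIP[yS yB].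
have xB : x \notin B by rewrite inB xC.
have xy : x != y by apply: contraNneq xB => ->.
have /andP[_] := cliqueP _ _ _ kS _ _ xS yS xy.
rewrite colE (negbTE xB) (negbTE (CA _ xC)); move: yB; rewrite inB => /andP[/negbTE-> /negbTE->].
by rewrite andbF.
Qed.

End LowerBound.

(** * The Ramsey number of disjoint copies of a complete graph *)

Lemma ramsey_copies_ge k n : 1 < k -> 0 < n ->
  (2 * k - 1) * n + ramsey 'K_(k - 1) - 2 <= ramsey (copies n 'K_k).
Proof.
move=> k1 n0; rewrite leqNgt; apply/negP=> small.
have [c0 c0_free] : exists c : {ffun {set 'I_(ramsey 'K_(k - 1)).-1} -> bool},
    forall b, ~~ has_clique c b (k - 1) [set: 'I_(ramsey 'K_(k - 1)).-1].
  by apply: ramsey_extremal; rewrite subn_gt0.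
by have := not_arrows_extremal k1 n0 small c0_free; rewrite ramsey_arrows.
Qed.

Lemma copies_size_leq k : 1 < k -> copies_size k + 2 * core_size k <= 2 ^ (40 * k).
Proof.
(* The total is at most five times [M], hence at most 2^(31k + 13), and 13 <= 9k. *)
move=> k1; pose M := 2 ^ (31 * k + 10).
have le e : e <= 31 * k + 10 -> 2 ^ e <= M by move=> ?; rewrite leq_exp2l.
have core_le : core_size k <= M.
  rewrite /core_size -expnD /M (_ : 31 * k + 10 = (31 * k + 9).+1); last by clear; lia.
  rewrite expnS (_ : 3 * k + 4 + (28 * k + 5) = 31 * k + 9); last by clear; lia.
  have : 2 ^ (2 * k) + 2 <= 2 ^ (31 * k + 9); last by clear; lia.
  apply: leq_trans (_ : 2 ^ (2 * k).+1 <= _); last by rewrite leq_exp2l //; clear; lia.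
  have : 2 ^ 1 <= 2 ^ (2 * k) by rewrite leq_exp2l //; move: k1; clear; lia.
  by rewrite expn1 [2 ^ (2 * k).+1]expnS; clear; set x := 2 ^ _; lia.
have asym_le : (asym_size k.-1 k).+1 <= M.
  apply: leq_trans (_ : 2 ^ (9 * k + 6) <= _); last by apply: le; clear; lia.
  by rewrite /asym_size ltn_exp2l //; move: k1; clear; lia.
have kk : k <= 2 ^ k by apply/ltnW/ltn_expl.
have rest_le : 10 * k * (2 ^ (k + 2) + k * (5 * k * 2 ^ (2 * k))) <= M.
  apply: leq_trans (_ : 2 ^ 4 * 2 ^ k * (2 ^ (4 * k + 3) + 2 ^ (4 * k + 3)) <= _).
    apply: leq_mul; first exact: leq_mul.
    apply: leq_add; first by rewrite leq_exp2l //; clear; lia.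
    rewrite (_ : 4 * k + 3 = k + (3 + k + 2 * k)); last by clear; lia.
    by rewrite !expnD; apply: leq_mul => //; apply: leq_mul => //; apply: leq_mul.
  rewrite addnn -mul2n -expnS -!expnD; apply: le; clear; lia.
apply: leq_trans (_ : 2 ^ 3 * M <= _).
  by rewrite /copies_size; move: core_le asym_le rest_le; clear;
     set x := (asym_size _ _).+1; set y := 10 * k * _; set z := core_size k; lia.
by rewrite -expnD leq_exp2l //; move: k1; clear; lia.
Qed.

Theorem theorem3 (R : realType) :
  exists2 C : R, (0 < C)%R &
    forall k n : nat, 2 <= k -> (2 `^ (C * k%:R) <= n%:R :> R)%R ->
      ramsey (copies n 'K_k) = (2 * k - 1) * n + ramsey 'K_(k - 1) - 2.
Proof.
exists 40%:R%R; first by rewrite ltr0n.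
move=> k n k2; rewrite -natrM powR_mulrn ?ler0n // -natrX ler_nat => n_big.
have n_size := leq_trans (copies_size_leq k2) n_big.
have n0 : 0 < n by apply: leq_trans n_big; rewrite expn_gt0.
apply/eqP; rewrite eqn_leq ramsey_copies_ge // andbT.
have r0 : 0 < ramsey 'K_(k - 1) by rewrite ramsey_complete_gt0 // subn_gt0.
have kn0 : 3 <= (2 * k - 1) * n by rewrite -[3]muln1; apply: leq_mul => //; move: k2; clear; lia.
set N := _ - 2; apply: ramsey_min; apply: arrows_copies.
  by rewrite /N; move: r0 kn0; clear; lia.
move=> c; apply: (@packs_upper _ c k (ramsey 'K_(k - 1)) k2 _ n n_size).
  by move=> W; rewrite -subn1; apply: ramsey_has_clique.
by rewrite card_ord /N; clear; lia.
Qed.
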